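(* Let $X$ and $Y$ be Banach spaces and $G\in\mathcal{L}(X,Y)$. If $G$ is a Daugavet center, then $\|G+T\|_L=\|G\|+\|T\|_L$ for every $T\in\mathrm{Lip}_0(X,Y)$ such that $\overline{\mathrm{conv}}(\mathrm{slope}(T))$ has one of the following properties: the Radon-Nikodým property, the Asplund property, the convex point of continuity property (CPCP), or absence of $\ell_1$-sequences.
   Context: $X,Y$ are Banach spaces over the same field (real or complex). $\mathcal{L}(X,Y)$ is the space of bounded linear operators. $G\in\mathcal{L}(X,Y)$ is a Daugavet center if $\|G+R\|=\|G\|+\|R\|$ for every rank-one operator $R\in\mathcal{L}(X,Y)$. $\mathrm{Lip}_0(X,Y)$ is the space of Lipschitz maps $T:X\to Y$ with $T(0)=0$, with norm $\|T\|_L=\sup\{\|Tu-Tv\|/\|u-v\|: u\ne v\}$. The slope of $T$ is $\mathrm{slope}(T)=\left\{\frac{Tu-Tv}{\|u-v\|}: u,v\in X,\ u\ne v\right\}$, and $\overline{\mathrm{conv}}$ denotes closed convex hull. The listed properties are the standard ones for a closed convex bounded set $C$ in a Banach space $Y$: $C$ has the Radon-Nikodým property if every nonempty subset of $C$ has slices (nonempty intersections with open half-spaces) of arbitrarily small diameter; $C$ has the Asplund property if for every countable $A\subseteq C$ the seminormed space $(Y^*,\rho_A)$, $\rho_A(y^* )=\sup_{a\in A}|y^*(a)|$, is separable; $C$ has CPCP if every nonempty closed convex subset of $C$ has nonempty relatively weakly open subsets of arbitrarily small diameter; absence of $\ell_1$-sequences means that no sequence in $C$ is equivalent to the unit vector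 basis of $\ell_1$. *)

(* Defs.v *)
From HB Require Import structures.
From mathcomp Require Import all_boot all_order all_algebra.
From mathcomp Require Import complex.
From mathcomp Require Import all_classical all_reals all_analysis.

Set Implicit Arguments.
Unset Strict Implicit.
Unset Printing Implicit Defensive.
Import Order.TTheory GRing.Theory Num.Theory.
Import numFieldNormedType.Exports.

Local Open Scope classical_set_scope.
Local Open Scope ring_scope.

Variant scalar_kind := RealScalars | ComplexScalars.

Definition scalars (R : realType) (k : scalar_kind) : numFieldType :=
  match k with RealScalars => R | ComplexScalars => R[i]%C end.

Definition re (R : realType) (k : scalar_kind) : scalars R k -> R :=
  match k with RealScalars => id | ComplexScalars => @complex.Re R end.

Section Banach.
Context {R : realType} {k : scalar_kind}.
Local Notation K := (scalars R k).

(* The library norm `|x| takes its values in K, also when K is R[i] (it is then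
   a nonnegative real element of R[i]); rnorm is the same norm with values in R. *)
Definition rnorm {V : normedModType K} (x : V) : R := re `|x|.

Section Operators.
Context {X Y : normedModType K}.

Definition bounded_operators : set {linear X -> Y} :=
  [set G | continuous (G : X -> Y)].

(* The supremum is finite for bounded operators. *)
Definition opnorm (G : X -> Y) : R :=
  sup [set rnorm (G x) | x in [set x | rnorm x <= 1]].

Definition rank_one (G : X -> Y) : Prop :=
  exists2 y : Y, y != 0 & range G = range (fun a : K => a *: y).

Definition daugavet_center (G : {linear X -> Y}) : Prop :=
  forall S : {linear X -> Y}, bounded_operators S -> rank_one S ->
    opnorm (G \+ S) = opnorm G + opnorm S.

Definition Lip0 : set (X -> Y) := [set T | lipschitz T /\ T 0 = 0].

(* The supremum is finite for Lipschitz maps, and it is 0 when X is trivial. *)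
Definition lipnorm (T : X -> Y) : R :=
  sup [set r | exists u v, u != v /\ r = rnorm (T u - T v) / rnorm (u - v)].

Definition slope (T : X -> Y) : set Y :=
  [set y | exists u v, u != v /\ y = `|u - v|^-1 *: (T u - T v)].

End Operators.

(* The properties below are meant for closed, convex and bounded sets C. *)
Section Sets.
Context {Y : normedModType K}.
Implicit Types (A C D H U : set Y).

Definition dual : set {linear Y -> K^o} := @bounded_operators Y K^o.

(* In convex_set, over R[i] the coefficients are the elements t of R[i] with
   0 <= t <= 1, which are real: this is convexity over the reals. *)
Definition closed_convex_hull A : set Y :=
  closure (smallest (@convex_set K Y) A).

Definition diam A : \bar R :=
  ereal_sup [set (rnorm (u - v))%:E | u in A & v in A].

Definition open_half_space H : Prop :=
  exists (f : {linear Y -> K^o}) (a : R),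
    [/\ dual f, exists y, f y != 0 & H = [set y | a < re (f y)]].

(* The weak topology is the initial topology of the evaluation map
   Y -> \prod_(f in dual) K. *)
Definition dual_eval (y : Y) :
    prod_topology (fun _ : set_type dual => K^o) :=
  fun f => set_val f y.

Definition weakly_open U : Prop :=
  open (U : set (initial_topology dual_eval)).

Definition radon_nikodym_property C : Prop :=
  forall A, A `<=` C -> A !=set0 ->
  forall e : R, 0 < e ->
  exists H, [/\ open_half_space H, (A `&` H) !=set0
    & (diam (A `&` H) < e%:E)%E].

(* ereal_sup set0 = -oo, so rho set0 is -oo instead of 0; this does not affect
   separability. *)
Definition rho A (f : Y -> K) : \bar R :=
  ereal_sup [set (re `|f a|)%:E | a in A].

Definition dual_separable_for A : Prop :=
  exists D : set {linear Y -> K^o}, [/\ D `<=` dual, countable D &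
    forall f, dual f -> forall e : R, 0 < e ->
      exists2 g, D g & (rho A (f \- g)%R < e%:E)%E].

Definition asplund_property C : Prop :=
  forall A, A `<=` C -> countable A -> dual_separable_for A.

Definition CPCP C : Prop :=
  forall D, D `<=` C -> D !=set0 -> closed D -> @convex_set K Y D ->
  forall e : R, 0 < e ->
  exists U, [/\ weakly_open U, (D `&` U) !=set0
    & (diam (D `&` U) < e%:E)%E].

(* Equivalence with the unit vector basis (e_i) of l_1, whose finite linear
   combinations satisfy ||\sum_i a_i e_i|| = \sum_i |a_i|. *)
Definition l1_sequence (x : nat -> Y) : Prop :=
  exists c M : R, [/\ 0 < c, 0 < M & forall (n : nat) (a : nat -> K),
    c * (\sum_(i < n) re `|a i|) <= rnorm (\sum_(i < n) a i *: x i) /\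
    rnorm (\sum_(i < n) a i *: x i) <= M * (\sum_(i < n) re `|a i|)].

Definition no_l1_sequences C : Prop :=
  forall x : nat -> Y, (forall n, C (x n)) -> ~ l1_sequence x.

End Sets.
End Banach.

(* Main.v *)
Require Import Defs.
From HB Require Import structures.
From mathcomp Require Import all_boot all_order all_algebra.
From mathcomp Require Import complex.
From mathcomp Require Import all_classical all_reals all_analysis.
From mathcomp Require Import ring lra.
Import Order.TTheory GRing.Theory Num.Theory.
Import numFieldNormedType.Exports.
Local Open Scope classical_set_scope.
Local Open Scope ring_scope.
Set Implicit Arguments.
Unset Strict Implicit.
Unset Printing Implicit Defensive.

(** Let G be a Daugavet center. For a slice of the unit ball, a rank-one
perturbation yields a unit vector a of the slice with |G a + y| close to |G| +
|y|. If F is a real Lipschitz function, the support functional q(x) = sup_(w, l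
> 0) (F(w + l x) - F w) / l is sublinear, and a linear functional below q turns
a steep quotient of F into a slice of the unit ball, hence into another steep
quotient of F, taken in a direction a with |G a + y| close to |G| + |y|.
Averaging such quotients adaptively, one gets pairs (x, s), with x an average of
slopes of G and s the corresponding average of slopes of T, such that s lies in
a prescribed relatively weakly open piece of C and |x + y| is close to |G| +
|y|, even for finitely many y at once.

If C has the Radon-Nikodym property or CPCP, a weakly open piece of small
diameter around a point d of almost maximal norm suffices: take y = d, so that s
is close to d. In the other cases suppose that |G + T| < |G| + |T|. Branching
between functionals that are almost |T| on s and functionals that are almost |G|
on x (hence far below |T| on s) produces s_0, s_1, ... in C such that for every
subset of the indices some norm-one functional is large exactly on this subset.
This is an l_1-sequence. Finally, the span of an l_1-sequence carries
functionals with arbitrary signs, so a set with the Asplund property contains no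
l_1-sequence. *)

(** * Real parts and moduli of scalars *)

Section Scalars.
Context {R : realType} {k : scalar_kind}.
Local Notation K := (scalars R k).

(** The embedding of the reals into the scalars; real coefficients act on vectors over either field
    through it. *)
Definition rc : R -> K :=
  match k return R -> scalars R k with
  | RealScalars => id | ComplexScalars => real_complex R
  end.

Lemma rc_is_zmod_morphism : zmod_morphism rc.
Proof. by rewrite /rc; case: k => // x y; exact: rmorphB. Qed.

Lemma rc_is_monoid_morphism : monoid_morphism rc.
Proof. by rewrite /rc; case: k => //; split; [exact: rmorph1|exact: rmorphM]. Qed.

HB.instance Definition _ := GRing.isZmodMorphism.Build R K rc rc_is_zmod_morphism.
HB.instance Definition _ := GRing.isMonoidMorphism.Build R K rc rc_is_monoid_morphism.

Lemma re_is_zmod_morphism : zmod_morphism (@re R k).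
Proof. by rewrite /re; case: k => // -[? ?] [? ?]. Qed.

HB.instance Definition _ :=
  GRing.isZmodMorphism.Build K R (@re R k) re_is_zmod_morphism.

Lemma re_rcM (r : R) (z : K) : re (rc r * z) = r * re z.
Proof.
rewrite /re /rc; move: z; case: k => //= -[a b] /=.
by rewrite mul0r subr0.
Qed.

Lemma rcK : cancel rc (@re R k).
Proof. by rewrite /rc /re; case: k. Qed.

Lemma rcN1 : rc (-1) = -1.
Proof. by rewrite rmorphN rmorph1. Qed.

Lemma norm_rcE (z : K) : `|z| = rc (re `|z|).
Proof. by rewrite /re /rc; move: z; case: k => //= z; rewrite normc_def. Qed.

Lemma ler_rc (r s : R) : (rc r <= rc s) = (r <= s).
Proof. by rewrite /rc; case: k => //=; rewrite lecR. Qed.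

Lemma ltr_rc (r s : R) : (rc r < rc s) = (r < s).
Proof. by rewrite /rc; case: k => //=; rewrite ltcR. Qed.

Lemma re_le_norm (z : K) : re z <= re `|z|.
Proof.
rewrite /re; move: z; case: k => /= [z|z]; first exact: ler_norm.
case: z => a b /=; rewrite (le_trans (ler_norm a))// -sqrtr_sqr ler_sqrt//.
  by rewrite lerDl sqr_ge0.
by rewrite addr_ge0// sqr_ge0.
Qed.

Lemma norm_rc (r : R) : `|rc r| = rc `|r|.
Proof.
rewrite /rc; case: k => //=; rewrite normc_def /= expr0n /= addr0.
by rewrite sqrtr_sqr.
Qed.

Definition nm (z : K) : R := re `|z|.

Lemma nmE (z : K) : `|z| = rc (nm z).
Proof. exact: norm_rcE. Qed.

Lemma nmM (z w : K) : nm (z * w) = nm z * nm w.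
Proof. by rewrite {1}/nm normrM (nmE z) re_rcM. Qed.

Lemma nm_ge0 (z : K) : 0 <= nm z.
Proof. by rewrite -ler_rc rmorph0 -nmE. Qed.

Lemma nmD (z w : K) : nm (z + w) <= nm z + nm w.
Proof. by rewrite -ler_rc rmorphD /= -!nmE; exact: ler_normD. Qed.

Lemma nm_rc (r : R) : nm (rc r) = `|r|.
Proof. by rewrite /nm norm_rc rcK. Qed.

Lemma nm0 : nm 0 = 0.
Proof. by rewrite /nm normr0 raddf0. Qed.

Lemma nm1 : nm 1 = 1.
Proof. by rewrite -[1](rmorph1 rc) nm_rc normr1. Qed.

Lemma nmN (z : K) : nm (- z) = nm z.
Proof. by rewrite /nm normrN. Qed.

Lemma nmB (z w : K) : nm (z - w) <= nm z + nm w.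
Proof. by rewrite -[nm w]nmN nmD. Qed.

Lemma nm_eq0 (z : K) : (nm z == 0) = (z == 0).
Proof. by rewrite -(inj_eq (can_inj rcK)) -nmE rmorph0 normr_eq0. Qed.

Lemma phase (z : K) : exists c : K, nm c = 1 /\ c * z = rc (nm z).
Proof.
have [->|z0] := eqVneq z 0; first by exists 1; rewrite nm1 mulr0 nm0 rmorph0.
exists (`|z| / z); split; last by rewrite divfK// nmE.
by rewrite /nm normf_div normr_id divff ?normr_eq0// -(rmorph1 rc) rcK.
Qed.

Lemma re_le_nm (z : K) : re z <= nm z.
Proof. exact: re_le_norm. Qed.

(* The law of cosines, with one real argument. *)
Lemma nm_subr_sqr (z : K) (t : R) :
  nm (z - rc t) ^+ 2 = nm z ^+ 2 - t * re z *+ 2 + t ^+ 2.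
Proof.
rewrite /nm /re /rc; move: z; case: k => /= [z|[a b]].
  by rewrite !real_normK ?num_real//; ring.
rewrite /= !sqr_sqrtr ?addr_ge0 ?sqr_ge0//; ring.
Qed.

End Scalars.

(** * Real-valued norms *)

Section Norm.
Context {R : realType} {k : scalar_kind}.
Local Notation K := (scalars R k).
Context {V : normedModType K}.
Implicit Types x y : V.

Lemma normE x : `|x| = rc (rnorm x).
Proof.
rewrite /rnorm; have := normr_ge0 x; rewrite /rc /re; move: (`|x|).
case: k => //= z; rewrite lecE /= => /andP[/eqP z0 _].
by case: z z0 => a b /= ->.
Qed.

Lemma rnorm_ge0 x : 0 <= rnorm x.
Proof. by rewrite -(ler_rc (k := k)) rmorph0 -normE. Qed.

Lemma rnormD x y : rnorm (x + y) <= rnorm x + rnorm y.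
Proof. by rewrite -(ler_rc (k := k)) rmorphD /= -!normE; exact: ler_normD. Qed.

Lemma rnormN x : rnorm (- x) = rnorm x.
Proof. by rewrite /rnorm normrN. Qed.

Lemma rnormB x y : rnorm (x - y) <= rnorm x + rnorm y.
Proof. by rewrite -[rnorm y]rnormN rnormD. Qed.

Lemma rnorm_subC x y : rnorm (x - y) = rnorm (y - x).
Proof. by rewrite -rnormN opprB. Qed.

Lemma rnorm0 : rnorm (0 : V) = 0.
Proof. by rewrite /rnorm normr0 raddf0. Qed.

Lemma rnorm_eq0 x : (rnorm x == 0) = (x == 0).
Proof. by rewrite -(inj_eq (can_inj (@rcK R k))) -normE rmorph0 normr_eq0. Qed.

Lemma rnorm_gt0 x : (0 < rnorm x) = (x != 0).
Proof. by rewrite lt_neqAle rnorm_ge0 andbT eq_sym rnorm_eq0. Qed.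

Lemma rnormZ (a : K) x : rnorm (a *: x) = nm a * rnorm x.
Proof. by apply: (can_inj (@rcK R k)); rewrite -normE normrZ nmE normE rmorphM. Qed.

Lemma rnorm_rcZ (r : R) x : rnorm (rc r *: x) = `|r| * rnorm x.
Proof. by rewrite rnormZ nm_rc. Qed.

Lemma rnorm_geB x y : rnorm x - rnorm y <= rnorm (x + y).
Proof. by have := rnormB (x + y) y; rewrite addrK lerBlDr. Qed.

Lemma ler_rnorm_sum (I : Type) (s : seq I) (P : pred I) (F : I -> V) :
  rnorm (\sum_(i <- s | P i) F i) <= \sum_(i <- s | P i) rnorm (F i).
Proof.
elim/big_rec2 : _ => [|i y1 y2 _ h]; first by rewrite rnorm0.
by apply: le_trans (rnormD _ _) _; rewrite lerD2l.
Qed.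

End Norm.

(** * The Hahn-Banach theorem *)

Section HahnBanach.
Context {R : realType} {k : scalar_kind}.
Local Notation K := (scalars R k).
Context {V : lmodType K}.
Implicit Types (x y : V) (p q f : V -> R).

(** Homogeneity is asked only as an inequality for [r > 0]: applied to [1/r] it yields the reverse
    one. *)
Definition sublinear p :=
  (forall x y, p (x + y) <= p x + p y) /\
  (forall r x, 0 < r -> p (rc r *: x) <= r * p x).

Definition real_linear f :=
  (forall x y, f (x + y) = f x + f y) /\ (forall r x, f (rc r *: x) = r * f x).

Lemma rcZA (r s : R) x : rc (k := k) r *: (rc s *: x) = rc (r * s) *: x.
Proof. by rewrite scalerA rmorphM. Qed.

Lemma rc1Z x : rc (k := k) 1 *: x = x.
Proof. by rewrite rmorph1 scale1r. Qed.

Lemma sublinearZ p : sublinear p ->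
  forall r x, 0 < r -> p (rc r *: x) = r * p x.
Proof.
move=> [_ pZ] r x r0; apply/eqP; rewrite eq_le pZ//=.
have ri0 : 0 < r^-1 by rewrite invr_gt0.
have := pZ _ (rc r *: x) ri0; rewrite rcZA mulVf ?gt_eqF// rc1Z => h.
by rewrite -(ler_pM2l ri0) mulrA mulVf ?gt_eqF// mul1r.
Qed.

Lemma sublinear0 p : sublinear p -> p 0 = 0.
Proof.
move=> sp; have := sublinearZ sp (r := 2) 0 ltac:(by []).
by rewrite scaler0 => h; lra.
Qed.

Lemma sublinear_ge p : sublinear p -> forall x, - p (- x) <= p x.
Proof.
move=> sp x; have := sp.1 x (- x); rewrite subrr (sublinear0 sp).
by move=> h; lra.
Qed.

(** The index [l] may depend on [i], [j] and [r], so families indexed by step lengths, chains or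
    finite combinations all fit. The minorant [B] keeps the infima finite. *)
Lemma inf_sublinear (I : Type) (D : set I) (F : I -> V -> R) (B : V -> R) :
  D !=set0 ->
  (forall i x, D i -> B x <= F i x) ->
  (forall i j x y, D i -> D j -> exists2 l, D l & F l (x + y) <= F i x + F j y) ->
  (forall i r x, 0 < r -> D i -> exists2 l, D l & F l (rc r *: x) <= r * F i x) ->
  sublinear (fun x => inf [set F i x | i in D]).
Proof.
move=> [i0 Di0] lb FD FZ.
have hlb x : has_lbound [set F i x | i in D].
  by exists (B x) => _ [i Di <-]; exact: lb.
have ne x : [set F i x | i in D] !=set0 by exists (F i0 x); exists i0.
have le i x : D i -> inf [set F i x | i in D] <= F i x.
  by move=> Di; apply: ge_inf => //; exists i.
split=> [x y|r x r0].
- rewrite -lerBlDl; apply: lb_le_inf => // _ [j Dj <-].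
  rewrite lerBlDl -lerBlDr; apply: lb_le_inf => // _ [i Di <-].
  rewrite lerBlDr; have [l Dl h] := FD i j x y Di Dj.
  exact: le_trans (le _ _ Dl) h.
- rewrite -ler_pdivrMl//; apply: lb_le_inf => // _ [i Di <-].
  rewrite ler_pdivrMl//; have [l Dl h] := FZ i r x r0 Di.
  exact: le_trans (le _ _ Dl) h.
Qed.

(** The usual modification of [p] in the direction [y]: for sublinear [p] it is sublinear, below
    [p], and at most [- p y] at [- y], so a linear functional below it equals [p] at [y]. *)
Definition directional_inf p y x :=
  inf [set p (x + rc t *: y) - t * p y | t in [set t | 0 < t]].

Section Direction.
Variables (p : V -> R) (y : V).
Hypothesis sp : sublinear p.

Lemma directional_lb t x : 0 < t -> - p (- x) <= p (x + rc t *: y) - t * p y.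
Proof.
move=> t0; have := sp.1 (x + rc t *: y) (- x).
by rewrite addrAC subrr add0r (sublinearZ sp)// => h; lra.
Qed.

Lemma directional_inf_sublinear : sublinear (directional_inf p y).
Proof.
apply: (@inf_sublinear _ [set t | 0 < t] (fun t x => p (x + rc t *: y) - t * p y)
  (fun x => - p (- x))).
- by exists 1 => /=.
- by move=> t x t0; exact: directional_lb.
- move=> s t x x' /= s0 t0; exists (s + t); first by rewrite /= addr_gt0.
  have := sp.1 (x + rc s *: y) (x' + rc t *: y).
  by rewrite rmorphD scalerDl addrACA => h; lra.
- move=> t r x r0 /= t0; exists (r * t); first by rewrite /= mulr_gt0.
  by rewrite -rcZA -scalerDr (sublinearZ sp)//; lra.
Qed.

Lemma directional_inf_le x : directional_inf p y x <= p x.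
Proof.
apply: (@le_trans _ _ (p (x + rc 1 *: y) - 1 * p y)).
  apply: ge_inf; last by exists 1 => //=.
  by exists (- p (- x)) => _ [t t0 <-]; exact: directional_lb.
by rewrite rc1Z; have := sp.1 x y; lra.
Qed.

Lemma directional_infN : directional_inf p y (- y) <= - p y.
Proof.
apply: (@le_trans _ _ (p (- y + rc 1 *: y) - 1 * p y)).
  apply: ge_inf; last by exists 1 => //=.
  by exists (- p (- (- y))) => _ [t t0 <-]; exact: directional_lb.
by rewrite rc1Z addNr sublinear0//; lra.
Qed.

End Direction.

(** Minimality forces [f] to equal [directional_inf f y], so [f (- y) <= - f y] for every [y]; an
    odd sublinear function is linear. *)
Lemma minimal_sublinear_linear f : sublinear f ->
  (forall q, sublinear q -> (forall x, q x <= f x) -> q = f) -> real_linear f.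
Proof.
move=> sf fmin.
have fN y : f (- y) = - f y.
  apply/eqP; rewrite eq_le; apply/andP; split; last first.
    by have := sublinear_ge sf (- y); rewrite opprK.
  have e := fmin _ (directional_inf_sublinear y sf) (directional_inf_le y sf).
  by have := directional_infN y sf; rewrite e.
split=> [x y|r x].
- apply/eqP; rewrite eq_le (sf.1 x y)/=.
  have := sf.1 (- x) (- y); rewrite -opprD !fN => h; lra.
- have [r0|r0|->] := ltgtP r 0; last by rewrite rmorph0 scale0r (sublinear0 sf) mul0r.
    have : f (rc (- r) *: x) = - r * f x by rewrite (sublinearZ sf)// oppr_gt0.
    by rewrite rmorphN scaleNr fN mulNr => /oppr_inj.
  exact: sublinearZ.
Qed.

Lemma sublinear_minorant p : sublinear p ->
  exists f, real_linear f /\ forall x, f x <= p x.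
Proof.
move=> sp.
pose T := {q | sublinear q /\ forall x, q x <= p x}.
have mk q (sq : sublinear q) (qp : forall x, q x <= p x) : {t : T | sval t = q}.
  by exists (exist _ q (conj sq qp)).
(* The order is reversed: a maximal element for [Q] is a pointwise minimal sublinear function. *)
pose Q (s t : T) := `[< forall x, sval t x <= sval s x >].
have [| | |A tot|m mmin] := @Zorn T Q.
- by move=> t; apply/asboolP => x.
- move=> r s t /asboolP h1 /asboolP h2; apply/asboolP => x.
  exact: le_trans (h2 x) (h1 x).
- move=> [s hs] [t ht] /asboolP /= h1 /asboolP /= h2; apply: eq_exist.
  by apply/funext => x; apply/eqP; rewrite eq_le h1 h2.
- have [[t0 At0]|/set0P/negP/negPn/eqP A0] := pselect (A !=set0); last first.
    by exists (exist _ p (conj sp (fun x => lexx _))) => s; rewrite A0.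
  have lb (s : T) x : - p (- x) <= sval s x.
    case: s => q /= [sq qp]; apply: le_trans (sublinear_ge sq x).
    by rewrite lerN2.
  have st : sublinear (fun x => inf [set sval s x | s in A]).
    apply: (@inf_sublinear _ A (fun s => sval s) (fun x => - p (- x))).
    + by exists t0.
    + by move=> s x _; exact: lb.
    + move=> s t x y As At; have [/asboolP|/asboolP] := tot _ _ As At => h.
        by exists t => //; rewrite (le_trans ((svalP t).1.1 x y))// lerD2r.
      by exists s => //; rewrite (le_trans ((svalP s).1.1 x y))// lerD2l.
    + by move=> s r x r0 As; exists s => //; exact: (svalP s).1.2.
  have le s x : A s -> inf [set sval s x | s in A] <= sval s x.
    move=> As; apply: ge_inf; last by exists s.
    by exists (- p (- x)) => _ [t _ <-]; exact: lb.
  have tp x : inf [set sval s x | s in A] <= p x.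
    exact: le_trans (le _ x At0) ((svalP t0).2 x).
  have [t tE] := mk _ st tp.
  by exists t => s As; apply/asboolP => x; rewrite tE; exact: le.
exists (sval m); split; last exact: (svalP m).2.
apply: minimal_sublinear_linear; first exact: (svalP m).1.
move=> q sq qm.
have qp x : q x <= p x by exact: le_trans (qm x) ((svalP m).2 x).
have [t tE] := mk _ sq qp.
by rewrite -(mmin t) ?tE//; apply/asboolP; rewrite tE.
Qed.

Theorem hahn_banach p y : sublinear p ->
  exists f, [/\ real_linear f, forall x, f x <= p x & f y = p y].
Proof.
move=> sp; have [f [lf fp]] := sublinear_minorant (directional_inf_sublinear y sp).
exists f; split=> // [x|]; first exact: le_trans (fp x) (directional_inf_le y sp x).
apply/eqP; rewrite eq_le (le_trans (fp y) (directional_inf_le y sp y))/=.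
have := le_trans (fp (- y)) (directional_infN y sp).
by rewrite -scaleN1r -rcN1 lf.2 mulN1r lerN2.
Qed.

End HahnBanach.

(** * Real functionals and operator norms *)

Section Functionals.
Context {R : realType} {k : scalar_kind}.
Local Notation K := (scalars R k).
Context {V : normedModType K}.
Implicit Types (x y : V) (f g : V -> R).

(** Real-linear over either field: separation arguments use real parts only, and [complexify] leads
    back to scalar functionals. *)
Definition rdual g := real_linear g /\ exists M, forall x, g x <= M * rnorm x.

(** The dual unit ball; the one-sided bound also controls [- g], through [- x]. *)
Definition rball g := real_linear g /\ forall x, g x <= rnorm x.

Lemma real_linear0 f : real_linear f -> f 0 = 0.
Proof. by case=> fD _; have := fD 0 0; rewrite addr0 => h; lra. Qed.

Lemma real_linearN f x : real_linear f -> f (- x) = - f x.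
Proof. by case=> fD fZ; rewrite -scaleN1r -rcN1 fZ mulN1r. Qed.

Lemma real_linearB f x y : real_linear f -> f (x - y) = f x - f y.
Proof. by move=> lf; rewrite lf.1 real_linearN. Qed.

Lemma rball_dual g : rball g -> rdual g.
Proof. by move=> [lg gb]; split => //; exists 1 => x; rewrite mul1r. Qed.

Lemma rball_ge g x : rball g -> - rnorm x <= g x.
Proof. by move=> [lg gb]; have := gb (- x); rewrite real_linearN// rnormN => h; lra. Qed.

Lemma norming y : exists g, rball g /\ g y = rnorm y.
Proof.
have sn : sublinear (@rnorm R k V).
  by split=> [x z|r x r0]; rewrite ?rnormD// rnorm_rcZ gtr0_norm.
by have [g [lg gb gy]] := hahn_banach y sn; exists g.
Qed.

Lemma rdual_comb (I : Type) (s : seq I) (c : I -> R) (F : I -> V -> R) :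
  (forall i, rdual (F i)) -> rdual (fun x => \sum_(i <- s) c i * F i x).
Proof.
move=> FV; split.
  split=> [x y|r x].
    rewrite -big_split /=; apply: eq_bigr => i _.
    by rewrite (FV i).1.1 mulrDr.
  by rewrite mulr_sumr; apply: eq_bigr => i _; rewrite (FV i).1.2 mulrCA.
have bound i : exists N, forall x, c i * F i x <= N * rnorm x.
  have [lF [M Mb]] := FV i; exists (`|c i| * M) => x.
  have h1 := Mb x; have := Mb (- x); rewrite real_linearN// rnormN => h2.
  have [c0|c0] := ler0P (c i); last by rewrite -mulrA ler_pM2l.
  by rewrite -mulrNN -mulrA ler_wpM2l// oppr_ge0.
elim: s => [|i s [N Nb]].
  by exists 0 => x; rewrite big_nil mul0r.
have [M Mb] := bound i; exists (M + N) => x.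
by rewrite big_cons mulrDl lerD.
Qed.

End Functionals.

(** * Bounded operators, operator norm and Lipschitz norm *)

Section Bounds.
Context {R : realType} {k : scalar_kind}.
Local Notation K := (scalars R k).
Context {X Y : normedModType K}.

Lemma gt0_rcE (M : K) : 0 < M -> M = rc (nm M).
Proof. by move=> M0; rewrite -nmE gtr0_norm. Qed.

Lemma continuous_linear_boundP (F : {linear X -> Y}) :
  continuous F <-> exists M, forall x, rnorm (F x) <= M * rnorm x.
Proof.
split=> [cF|[M Mb]]; last first.
  apply: bounded_linear_continuous; apply/linear_boundedP.
  exists (rc `|M|); split; first by rewrite -norm_rc normr_real.
  move=> z Mz x; have z0 : 0 < z by apply: le_lt_trans Mz; rewrite -norm_rc.
  rewrite (gt0_rcE z0) !normE -rmorphM /= ler_rc.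
  apply: le_trans (Mb x) _; rewrite ler_wpM2r ?rnorm_ge0//.
  apply: le_trans (ler_norm _) _; apply: ltW.
  by rewrite -(ltr_rc (k := k)) -(gt0_rcE z0).
have := continuous_linear_bounded 0 (cF 0).
move=> /linear_boundedP /pinfty_ex_gt0 [M M0 Mb]; exists (nm M) => x.
by rewrite -(ler_rc (k := k)) rmorphM /= -(gt0_rcE M0) -!normE.
Qed.

Lemma lipschitz_rnorm (T : X -> Y) : lipschitz T ->
  exists L, forall u v, rnorm (T u - T v) <= L * rnorm (u - v).
Proof.
move=> /pinfty_ex_gt0 [M M0 Mb]; exists (nm M) => u v.
rewrite -(ler_rc (k := k)) rmorphM /= -(gt0_rcE M0) -!normE.
exact: (Mb (u, v)).
Qed.

Section Opnorm.
Variables (F : X -> Y) (M : R).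
Hypothesis FM : forall x, rnorm (F x) <= M * rnorm x.

Let has_sup_opnorm : has_sup [set rnorm (F x) | x in [set x | rnorm x <= 1]].
Proof.
split; first by exists (rnorm (F 0)), 0 => //=; rewrite rnorm0.
exists `|M| => _ [x /= x1 <-]; apply: le_trans (FM x) _.
apply: le_trans (_ : `|M| * rnorm x <= _).
  by rewrite ler_wpM2r ?rnorm_ge0 ?ler_norm.
by rewrite ler_piMr.
Qed.

Lemma opnorm_ub x : rnorm x <= 1 -> rnorm (F x) <= opnorm F.
Proof. by move=> x1; apply: ub_le_sup; [exact: has_sup_opnorm.2|exists x]. Qed.

Lemma opnorm_ge0 : 0 <= opnorm F.
Proof. by apply: le_trans (rnorm_ge0 (F 0)) _; apply: opnorm_ub; rewrite rnorm0. Qed.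

Lemma opnorm_le c : (forall x, rnorm x <= 1 -> rnorm (F x) <= c) -> opnorm F <= c.
Proof.
move=> h; apply: ge_sup; first exact: has_sup_opnorm.1.
by move=> _ [x x1 <-]; exact: h.
Qed.

Lemma opnorm_adherent e : 0 < e ->
  exists2 x, rnorm x <= 1 & opnorm F - e < rnorm (F x).
Proof.
by move=> e0; have [_ [x x1 <-] h] := sup_adherent e0 has_sup_opnorm; exists x.
Qed.

End Opnorm.

Lemma opnorm_le_norm (F : {linear X -> Y}) x :
  continuous F -> rnorm (F x) <= opnorm F * rnorm x.
Proof.
move=> /continuous_linear_boundP [M Mb].
have [->|x0] := eqVneq x 0; first by rewrite linear0 !rnorm0 mulr0.
have nx : 0 < rnorm x by rewrite rnorm_gt0.
have := @opnorm_ub F M Mb (rc (rnorm x)^-1 *: x).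
rewrite rnorm_rcZ gtr0_norm ?invr_gt0// mulVf ?gt_eqF// => /(_ (lexx _)).
by rewrite linearZ /= rnorm_rcZ gtr0_norm ?invr_gt0// mulrC ler_pdivrMr.
Qed.

Section Lipnorm.
Variables (T : X -> Y) (L : R).
Hypothesis TL : forall u v, rnorm (T u - T v) <= L * rnorm (u - v).

Lemma lipnorm_ub u v : rnorm (T u - T v) <= lipnorm T * rnorm (u - v).
Proof.
have [->|uv] := eqVneq u v; first by rewrite !subrr !rnorm0 mulr0.
have n0 : 0 < rnorm (u - v) by rewrite rnorm_gt0 subr_eq0.
rewrite -ler_pdivrMr//; apply: ub_le_sup; last by exists u, v.
exists L => _ [u' [v' [uv' ->]]].
by rewrite ler_pdivrMr// rnorm_gt0 subr_eq0.
Qed.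

Hypothesis X_neq0 : exists u v : X, u != v.

Lemma lipnorm_le c :
  (forall u v, rnorm (T u - T v) <= c * rnorm (u - v)) -> lipnorm T <= c.
Proof.
move=> h; apply: ge_sup; first by have [u [v uv]] := X_neq0; eexists; exists u, v.
by move=> _ [u [v [uv ->]]]; rewrite ler_pdivrMr// rnorm_gt0 subr_eq0.
Qed.

Lemma lipnorm_adherent e : 0 < e ->
  exists u v, u != v /\ lipnorm T - e < rnorm (T u - T v) / rnorm (u - v).
Proof.
move=> e0; have hs : has_sup [set r | exists u v : X, u != v /\
    r = rnorm (T u - T v) / rnorm (u - v)].
  split; first by have [u [v uv]] := X_neq0; eexists; exists u, v.
  exists L => _ [u [v [uv ->]]]; by rewrite ler_pdivrMr// rnorm_gt0 subr_eq0.
by have [_ [u [v [uv ->]]] h] := sup_adherent e0 hs; exists u, v.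
Qed.

End Lipnorm.

End Bounds.

(** * Real functionals as real parts of scalar functionals *)

Section Complexify.
Context {R : realType} {k : scalar_kind}.
Local Notation K := (scalars R k).

Lemma complexify_linear (V : lmodType K) (g : V -> R) : real_linear g ->
  exists F : {linear V -> K^o}, forall x, re (F x) = g x.
Proof.
rewrite /real_linear /rc /re; move: V g; case: k => /= V g [gD gZ].
  have lg : linear (g : V -> R^o) by move=> a x y; rewrite gD gZ.
  pose G : {linear V -> R^o} := HB.pack g (GRing.isLinear.Build _ _ _ _ _ lg).
  by exists G.
(* The imaginary part at [x] has to be minus the real part at [i x]. *)
pose f (x : V) : R[i]^o := (g x +i* - g ('i%C *: x))%C.
have gN x : g (- x) = - g x.
  by have := gZ (-1) x; rewrite rmorphN rmorph1 scaleN1r mulN1r.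
have lf : linear f.
  move=> [a b] x y; rewrite /f.
  have -> : (a +i* b)%C = (a%:C + b%:C * 'i)%C by simpc.
  rewrite !(scalerDl, scalerDr, gD) !scalerA.
  have -> : ('i * a%:C)%C = (a%:C * 'i)%C :> R[i] by rewrite mulrC.
  have -> : ('i * (b%:C * 'i))%C = (- b)%:C%C :> R[i] by simpc.
  rewrite -!scalerA !gZ.
  by rewrite /GRing.scale /=; simpc; congr (_ +i* _)%C; rewrite ?gZ //=; ring.
pose G : {linear V -> R[i]^o} := HB.pack f (GRing.isLinear.Build _ _ _ _ _ lf).
by exists G.
Qed.

(** Multiplying [x] by a phase makes the value real and nonnegative without changing the norm of
    [x]. *)
Lemma nm_le_of_re (V : normedModType K) (F : {linear V -> K^o}) M :
  (forall x, re (F x) <= M * rnorm x) -> forall x, nm (F x) <= M * rnorm x.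
Proof.
move=> h x; have [c [c1 cF]] := phase (F x).
by have := h (c *: x); rewrite linearZ /= [c *: F x]cF rcK rnormZ c1 mul1r.
Qed.

Lemma rnorm_regular (z : K^o) : rnorm z = nm z.
Proof. by []. Qed.

Lemma complexify (V : normedModType K) (g : V -> R) M :
  real_linear g -> (forall x, g x <= M * rnorm x) ->
  exists F : {linear V -> K^o},
    [/\ dual F, forall x, re (F x) = g x & forall x, nm (F x) <= M * rnorm x].
Proof.
move=> lg gM; have [F Fg] := complexify_linear lg; exists F.
have FM : forall x, nm (F x) <= M * rnorm x.
  by apply: nm_le_of_re => x; rewrite Fg.
by split=> //; apply/continuous_linear_boundP; exists M.
Qed.

Lemma dual_rdual (V : normedModType K) (F : {linear V -> K^o}) :
  dual F -> rdual (fun x => re (F x)).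
Proof.
move=> /continuous_linear_boundP [M Mb]; split.
  by split=> [x y|r x]; rewrite ?linearD ?raddfD// linearZ /= [_ *: _]/(_ * _) re_rcM.
by exists M => x; apply: le_trans (re_le_nm _) (Mb x).
Qed.

End Complexify.

(** * Slices of the unit ball *)

Section Daugavet.
Context {R : realType} {k : scalar_kind}.
Local Notation K := (scalars R k).
Context {X Y : normedModType K}.
Variable G : {linear X -> Y}.
Hypotheses (cG : bounded_operators G) (daugG : daugavet_center G).

Lemma rank_one_operator (F : {linear X -> K^o}) (y : Y) :
  dual F -> (exists x, F x != 0) -> y != 0 ->
  exists S : {linear X -> Y},
    [/\ bounded_operators S, rank_one S & forall x, S x = F x *: y].
Proof.
move=> dF [x0 Fx0] y0.
have lS : linear (fun x => F x *: y).
  by move=> a u v; rewrite linearP scalerDl scalerA.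
pose S : {linear X -> Y} :=
  HB.pack (fun x => F x *: y) (GRing.isLinear.Build _ _ _ _ _ lS).
exists S; split=> //.
- have [M Mb] := (continuous_linear_boundP F).1 dF.
  apply/continuous_linear_boundP; exists (M * rnorm y) => x /=.
  by rewrite rnormZ mulrAC ler_wpM2r ?rnorm_ge0 ?Mb.
- exists y => //; apply/seteqP; split=> _ [a _ <-] /=; first by exists (F a).
  exists (a / F x0 *: x0) => //=; congr (_ *: _).
  by rewrite linearZ; exact: divfK.
Qed.

(** The Daugavet equation is applied to [S x = F x *: (y / m)], where [m = opnorm F]. A point almost
    norming [G + S] has [nm (F x)] almost equal to [m]; rotated and normalised, it is the required
    [a]. *)
Lemma daugavet_slice_dual (F : {linear X -> K^o}) (y : Y) eta :
  dual F -> (exists x, F x != 0) -> y != 0 -> 0 < eta ->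
  exists a, [/\ rnorm a = 1, opnorm F - eta < re (F a) &
    opnorm G + rnorm y - eta < rnorm (G a + y)].
Proof.
move=> dF [x0 Fx0] y0 eta0.
have [M Mb] := (continuous_linear_boundP F).1 dF.
have [MG MGb] := (continuous_linear_boundP G).1 cG.
have F0 : 0 < opnorm F.
  have n0 : 0 < nm (F x0) by rewrite lt_neqAle nm_ge0 eq_sym nm_eq0 Fx0.
  have := opnorm_le_norm x0 dF; rewrite rnorm_regular => h.
  have m0 := opnorm_ge0 Mb; rewrite lt_neqAle m0 andbT eq_sym.
  by apply/eqP => m; move: h; rewrite m mul0r leNgt n0.
set m := opnorm F in F0 *.
have ny : 0 < rnorm y by rewrite rnorm_gt0.
have y'0 : rc (k := k) m^-1 *: y != 0.
  by rewrite -rnorm_gt0 rnorm_rcZ mulr_gt0// normr_gt0 invr_neq0 ?gt_eqF.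
have [S [cS rS SE]] := rank_one_operator dF (ex_intro _ x0 Fx0) y'0.
have [MS MSb] := (continuous_linear_boundP S).1 cS.
have SnE x : rnorm (S x) = nm (F x) / m * rnorm y.
  by rewrite SE rnormZ rnorm_rcZ gtr0_norm ?invr_gt0// mulrA.
have yS : rnorm y <= opnorm S.
  have : m <= opnorm S * m / rnorm y.
    apply: (opnorm_le Mb) => x x1; rewrite ler_pdivlMr// -ler_pdivrMr//.
    by rewrite mulrAC -SnE; exact: opnorm_ub MSb _ x1.
  by rewrite ler_pdivlMr// mulrC ler_pM2r.
have nG := opnorm_ge0 MGb.
(* [B] dominates every factor that multiplies the tolerance [d] below. *)
pose B := 1 + eta + 2 * rnorm y + opnorm G + m.
have B0 : 0 < B by rewrite /B; lra.
pose d := eta / B.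
have d0 : 0 < d by rewrite divr_gt0.
have dB : d * B = eta by rewrite divfK// gt_eqF.
have d1 : d < 1 by rewrite ltr_pdivrMr// mul1r /B; lra.
have GSb x : rnorm ((G \+ S) x) <= (MG + MS) * rnorm x.
  by rewrite mulrDl; apply: le_trans (rnormD _ _) _; rewrite lerD.
have dy0 : 0 < d * rnorm y by rewrite mulr_gt0.
have [x x1] := opnorm_adherent GSb dy0.
rewrite (daugG cS rS) => hx.
have [c [c1 cF]] := phase (F x).
(* After rotation by [c], [F x' = m * rho] and [S x' = rho y]; both [rho] and the norm of [x'] turn
   out to exceed [1 - d]. *)
pose rho := nm (F x) / m.
pose x' := c *: x.
have x'1 : rnorm x' <= 1 by rewrite rnormZ c1 mul1r.
have Fx' : F x' = rc (m * rho) :> K.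
  by rewrite linearZ /= [c *: _]cF /rho mulrC divfK ?gt_eqF.
have rho0 : 0 <= rho by rewrite divr_ge0 ?nm_ge0 ?ltW.
have rhox : rho <= rnorm x'.
  have := opnorm_le_norm x' dF; rewrite -/m Fx' rnorm_regular nm_rc.
  have mr0 : 0 <= m * rho by rewrite mulr_ge0// ltW.
  by rewrite ger0_norm// ler_pM2l.
have hx' : opnorm G + rnorm y - d * rnorm y < rnorm (G x' + rc rho *: y).
  apply: (@lt_le_trans _ _ (rnorm (G x + S x))); first by move: hx => /=; lra.
  have -> : G x' + rc rho *: y = c *: (G x + S x).
    rewrite scalerDr -!linearZ /= SE -/x' Fx' scalerA -rmorphM /=.
    by rewrite mulrAC divff ?gt_eqF// mul1r.
  by rewrite rnormZ c1 mul1r.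
have hG := opnorm_le_norm x' cG.
have hGx : opnorm G * rnorm x' <= opnorm G by rewrite ler_piMr.
(* [G x'] contributes at most [opnorm G], so [rho y] must supply nearly all of the norm of [y]. *)
have hrho : 1 - rho < d.
  have := rnormD (G x') (rc rho *: y); rewrite rnorm_rcZ ger0_norm// => h.
  suff : (1 - rho) * rnorm y < d * rnorm y by rewrite ltr_pM2r.
  lra.
have n0 : 0 < rnorm x' by lra.
pose a := rc (rnorm x')^-1 *: x'.
have a1 : rnorm a = 1.
  by rewrite rnorm_rcZ gtr0_norm ?invr_gt0// mulVf// gt_eqF.
have ax : rnorm (a - x') <= 1 - rho.
  have -> : a - x' = rc ((rnorm x')^-1 - 1) *: x'.
    by rewrite rmorphB scalerBl rmorph1 scale1r.
  rewrite rnorm_rcZ ger0_norm ?subr_ge0 ?invf_ge1//.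
  by rewrite mulrBl mulVf ?gt_eqF// mul1r; lra.
exists a; split=> //.
- have Fa : F a = rc ((rnorm x')^-1 * (m * rho)).
    by rewrite linearZ Fx' [in RHS]rmorphM.
  rewrite Fa rcK.
  apply: (@lt_le_trans _ _ (m * rho)).
    have : m * (1 - rho) < eta; last by lra.
    apply: (@lt_le_trans _ _ (m * d)); first by rewrite ltr_pM2l.
    by rewrite -dB mulrC ler_pM2l// /B; lra.
  by rewrite ler_peMl ?invf_ge1// mulr_ge0// ltW.
- have -> : G a + y = (G x' + rc rho *: y) + (G (a - x') + rc (1 - rho) *: y).
    rewrite addrACA -linearD -scalerDl -rmorphD.
    by rewrite /= [x' + _]addrC subrK [rho + _]addrC subrK rmorph1 scale1r.
  have h := rnorm_geB (G x' + rc rho *: y) (G (a - x') + rc (1 - rho) *: y).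
  have h1 := rnormD (G (a - x')) (rc (1 - rho) *: y).
  have h2 := opnorm_le_norm (a - x') cG.
  have h3 : opnorm G * rnorm (a - x') <= opnorm G * d.
    by rewrite ler_wpM2l// (le_trans ax)// ltW.
  have h4 : rnorm (rc (1 - rho) *: y) <= d * rnorm y.
    rewrite rnorm_rcZ ger0_norm ?ler_pM2r// ?(ltW hrho)//; lra.
  have h5 : d * (opnorm G + 2 * rnorm y) < eta.
    by rewrite -dB ltr_pM2l// /B; lra.
  lra.
Qed.

(** Passes to real functionals and covers the degenerate cases [Y = 0], [y = 0] and [g = 0], where
    the given data define no rank-one operator. *)
Lemma daugavet_slice (g : X -> R) (z : X) (y : Y) eta :
  rdual g -> rnorm z = 1 -> 0 < eta ->
  exists a, [/\ rnorm a = 1, g z - eta < g a &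
    opnorm G + rnorm y - eta < rnorm (G a + y)].
Proof.
move=> [lg [M gM]] z1 eta0.
have [[y1 y10]|Y0] := pselect (exists y1 : Y, y1 != 0); last first.
  have Y0' (w : Y) : w = 0.
    by apply/eqP; apply: contrapT => /negP w0; apply: Y0; exists w.
  exists z; split; rewrite ?z1//; first lra.
  have G0 : opnorm G <= 0.
    have [MG MGb] := (continuous_linear_boundP G).1 cG.
    by apply: (opnorm_le MGb) => x _; rewrite (Y0' (G x)) rnorm0.
  by rewrite (Y0' y) (Y0' (_ + _)) rnorm0; lra.
suff [F [dF F0 H]] : exists F : {linear X -> K^o}, [/\ dual F, exists x, F x != 0
    & forall e, 0 < e ->
      forall a, rnorm a = 1 -> opnorm F - e < re (F a) -> g z - e < g a].
  have [y0|y0] := eqVneq y 0; last first.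
    have [a [a1 h1 h2]] := daugavet_slice_dual dF F0 y0 eta0.
    by exists a; split=> //; exact: H h1.
  (* For [y = 0] an auxiliary nonzero [y1] is used and then removed by the triangle inequality. *)
  have [a [a1 h1 h2]] := daugavet_slice_dual dF F0 y10 eta0.
  exists a; split=> //; first exact: H h1.
  rewrite y0 addr0 rnorm0; have := rnormD (G a) y1; lra.
have [[x gx]|g0] := pselect (exists x, 0 < g x).
  have [F [dF Fg _]] := complexify lg gM.
  have [x1|x1] := eqVneq x 0; first by rewrite x1 real_linear0 ?ltxx in gx.
  exists F; split=> // [|e e0 a a1].
    exists x; apply: contraTneq gx => Fx0.
    by rewrite -Fg Fx0 raddf0 ltxx.
  rewrite Fg; have [MF MFb] := (continuous_linear_boundP F).1 dF.
  have := opnorm_ub MFb (x := z); rewrite z1 => /(_ (lexx _)).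
  by have := re_le_nm (F z); rewrite Fg -rnorm_regular; lra.
have {}g0 x : g x = 0.
  have h x' : g x' <= 0 by rewrite leNgt; apply/negP => gx; apply: g0; exists x'.
  by apply/eqP; rewrite eq_le h/= -oppr_le0 -real_linearN.
(* For [g = 0] any nonzero functional will do, such as one norming [z]. *)
have [g' [[lg' g'b] g'z]] := norming z.
have [F [dF Fg _]] : exists F : {linear X -> K^o}, [/\ dual F,
    forall x, re (F x) = g' x & forall x, nm (F x) <= 1 * rnorm x].
  by apply: complexify => // x; rewrite mul1r.
exists F; split=> // [|e e0 a _ _]; last by rewrite !g0; lra.
exists z; apply/eqP => Fz; have := Fg z; rewrite g'z z1 Fz raddf0; lra.
Qed.

End Daugavet.

(** * Lipschitz slices and approachability *)

Section LipschitzSlices.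
Context {R : realType} {k : scalar_kind}.
Local Notation K := (scalars R k).
Context {X Y : normedModType K}.

Definition quotient_slope (V : normedModType K) (T : X -> V) (u v : X) : V :=
  `|u - v|^-1 *: (T u - T v).

Lemma quotient_slopeE (V : normedModType K) (T : X -> V) u v :
  quotient_slope T u v = rc (rnorm (u - v))^-1 *: (T u - T v).
Proof. by rewrite /quotient_slope normE fmorphV. Qed.

Definition slope_support (F : X -> R) (x : X) : R :=
  sup [set (F (w.1 + rc w.2 *: x) - F w.1) / w.2 | w in [set w : X * R | 0 < w.2]].

Section Support.
Variables (F : X -> R) (L : R).
Hypothesis FL : forall u v, F u - F v <= L * rnorm (u - v).

Let has_sup_slope x : has_sup
  [set (F (w.1 + rc w.2 *: x) - F w.1) / w.2 | w in [set w : X * R | 0 < w.2]].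
Proof.
split; first by exists ((F (0 + rc 1 *: x) - F 0) / 1), (0, 1) => /=.
exists (L * rnorm x) => _ [[w l] /= l0 <-]; rewrite ler_pdivrMr//.
apply: le_trans (FL _ _) _.
by rewrite [w + _]addrC addrK rnorm_rcZ gtr0_norm// mulrA mulrAC.
Qed.

Lemma slope_support_ge x w l : 0 < l ->
  (F (w + rc l *: x) - F w) / l <= slope_support F x.
Proof.
by move=> l0; apply: ub_le_sup; [exact: (has_sup_slope x).2|exists (w, l)].
Qed.

Lemma slope_support_le x c :
  (forall w l, 0 < l -> (F (w + rc l *: x) - F w) / l <= c) ->
  slope_support F x <= c.
Proof.
move=> h; apply: ge_sup; first exact: (has_sup_slope x).1.
by move=> _ [[w l] /= l0 <-]; exact: h.
Qed.

(** An increment of [F] along [l (x + y)] is one along [l x] followed by one along [l y] from the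
    new base point, and the supremum runs over all base points. *)
Lemma slope_support_sublinear : sublinear (slope_support F).
Proof.
split=> [x y|r x r0]; apply: slope_support_le => w l l0.
- have h1 := slope_support_ge x w l0.
  have h2 := slope_support_ge y (w + rc l *: x) l0.
  rewrite scalerDr addrA; apply: le_trans (lerD h1 h2).
  lra.
- rewrite rcZA; have lr : 0 < l * r by rewrite mulr_gt0.
  have := slope_support_ge x w lr.
  by rewrite [r * _]mulrC -ler_pdivrMr// -mulrA -invfM.
Qed.

Lemma slope_support_gt x c : c < slope_support F x ->
  exists w l, 0 < l /\ c < (F (w + rc l *: x) - F w) / l.
Proof.
move=> h; have [_ [[w l] /= l0 <-] hh] := sup_gt (has_sup_slope x).1 h.
by exists w, l.
Qed.

End Support.

Variable G : {linear X -> Y}.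
Hypotheses (cG : bounded_operators G) (daugG : daugavet_center G).

(** Hahn-Banach gives a linear [f] below [slope_support F], with equality at [u - v].
    [daugavet_slice] finds a unit vector [a] with [f a] large; as [f a <= slope_support F a], some
    quotient of [F] in the direction [a] is steep, and the slope of [G] there is [G a]. *)
Lemma lipschitz_slice (F : X -> R) L u v y eta :
  (forall u v, F u - F v <= L * rnorm (u - v)) -> u != v -> 0 < eta ->
  exists u' v', [/\ u' != v',
    (F u - F v) / rnorm (u - v) - eta < (F u' - F v') / rnorm (u' - v') &
    opnorm G + rnorm y - eta < rnorm (quotient_slope G u' v' + y)].
Proof.
move=> FL uv eta0.
have n0 : 0 < rnorm (u - v) by rewrite rnorm_gt0 subr_eq0.
have [f [lf fq fuv]] := hahn_banach (u - v) (slope_support_sublinear FL).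
have fL x : f x <= L * rnorm x.
  apply: le_trans (fq x) _; apply: (slope_support_le FL) => w l l0.
  rewrite ler_pdivrMr//; apply: le_trans (FL _ _) _.
  by rewrite [w + _]addrC addrK rnorm_rcZ gtr0_norm// mulrA mulrAC.
have fge : F u - F v <= f (u - v).
  rewrite fuv; have := slope_support_ge FL (u - v) v ltr01.
  by rewrite rc1Z subrKC divr1.
pose z := rc (rnorm (u - v))^-1 *: (u - v).
have z1 : rnorm z = 1 by rewrite rnorm_rcZ gtr0_norm ?invr_gt0// mulVf ?gt_eqF.
have df : rdual f by split => //; exists L.
have [a [a1 fa Ga]] := daugavet_slice cG daugG y df z1 eta0.
have : (F u - F v) / rnorm (u - v) - eta < slope_support F a.
  apply: (lt_le_trans _ (fq a)); apply: le_lt_trans fa.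
  by rewrite lerD2r /z lf.2 mulrC ler_pM2l// invr_gt0.
move=> /(slope_support_gt FL) [w [l [l0 hw]]].
have nl : rnorm (w + rc l *: a - w) = l.
  by rewrite [w + _]addrC addrK rnorm_rcZ a1 mulr1 gtr0_norm.
exists (w + rc l *: a), w; split.
- by rewrite -subr_eq0 -rnorm_eq0 nl gt_eqF.
- by rewrite nl.
- rewrite quotient_slopeE nl -linearB [w + _]addrC addrK linearZ /= rcZA.
  by rewrite mulVf ?gt_eqF// rc1Z.
Qed.

End LipschitzSlices.

(** * Averages of pairs of slopes and approachability *)

Section Averages.
Context {R : realType} {k : scalar_kind}.
Local Notation K := (scalars R k).
Context {Y : normedModType K}.

Definition pair_eval (phi : (Y -> R) * (Y -> R)) (p : Y * Y) : R :=
  phi.1 p.1 + phi.2 p.2.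

Definition pair_dual (phi : (Y -> R) * (Y -> R)) := rdual phi.1 /\ rdual phi.2.

Lemma pair_evalD phi p q : pair_dual phi ->
  pair_eval phi (p + q) = pair_eval phi p + pair_eval phi q.
Proof. by move=> [[l1 _] [l2 _]]; rewrite /pair_eval /= l1.1 l2.1 addrACA. Qed.

Lemma pair_evalZ phi r p : pair_dual phi ->
  pair_eval phi (rc r *: p) = r * pair_eval phi p.
Proof. by move=> [[l1 _] [l2 _]]; rewrite /pair_eval /= l1.2 l2.2 mulrDr. Qed.

Lemma pair_eval0 phi : pair_dual phi -> pair_eval phi 0 = 0.
Proof. by move=> [[l1 _] [l2 _]]; rewrite /pair_eval /= !real_linear0 ?addr0. Qed.

Variables (P0 : set (Y * Y)) (gam t : R).

(** The convex hull, generated by binary combinations so that its properties follow by induction. *)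
Inductive pair_hull : Y * Y -> Prop :=
| PairHullBase p : P0 p -> pair_hull p
| PairHullConv r p q : 0 <= r -> r <= 1 -> pair_hull p -> pair_hull q ->
    pair_hull (rc r *: p + rc (1 - r) *: q).

Hypothesis P0b : forall p, P0 p -> rnorm p.1 <= gam /\ rnorm p.2 <= t.
Hypothesis slices : forall phi p y eta, pair_dual phi -> P0 p -> 0 < eta ->
  exists q, [/\ P0 q, pair_eval phi p - eta < pair_eval phi q &
    gam + rnorm y - eta < rnorm (q.1 + y)].

Lemma pair_hull_bound p : pair_hull p -> rnorm p.1 <= gam /\ rnorm p.2 <= t.
Proof.
elim=> {p} [p /P0b//|r p q r0 r1 _ [p1 p2] _ [q1 q2]].
have bnd (x y : Y) c : rnorm x <= c -> rnorm y <= c ->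
    rnorm (rc r *: x + rc (1 - r) *: y) <= c.
  move=> xc yc; apply: le_trans (rnormD _ _) _.
  rewrite !rnorm_rcZ !ger0_norm ?subr_ge0//.
  have -> : c = r * c + (1 - r) * c by rewrite -mulrDl subrKC mul1r.
  by rewrite lerD// ler_wpM2l// subr_ge0.
by split; apply: bnd.
Qed.

(** At one of the points a linear functional is at least as large as at their convex combination. *)
Lemma pair_hull_slice p phi : pair_dual phi -> pair_hull p ->
  exists2 q, P0 q & pair_eval phi p <= pair_eval phi q.
Proof.
move=> dphi; elim=> {p} [p Pp|r p q r0 r1 _ [p' Pp' hp] _ [q' Pq' hq]].
  by exists p.
rewrite pair_evalD// !pair_evalZ//.
have h1 : r * pair_eval phi p <= r * pair_eval phi p' by rewrite ler_wpM2l.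
have h2 : (1 - r) * pair_eval phi q <= (1 - r) * pair_eval phi q'.
  by rewrite ler_wpM2l// subr_ge0.
have [h|h] := lerP (pair_eval phi p') (pair_eval phi q').
  exists q' => //; apply: le_trans (lerD h1 h2) _.
  have : r * pair_eval phi p' <= r * pair_eval phi q' by rewrite ler_wpM2l.
  lra.
exists p' => //; apply: le_trans (lerD h1 h2) _.
have : (1 - r) * pair_eval phi q' <= (1 - r) * pair_eval phi p'.
  by rewrite ler_wpM2l ?subr_ge0// ltW.
lra.
Qed.

Section Approach.
Variables (I : finType) (phi : I -> (Y -> R) * (Y -> R)) (c : I -> R).
Hypothesis dphi : forall i, pair_dual (phi i).
(** Dual form of the condition that [c] lies in the closed convex hull of the evaluation vectors of
    [P0]. *)
Hypothesis reachable : forall (w : I -> R) eta, 0 < eta -> exists2 p, P0 p &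
  \sum_i w i * c i - eta < \sum_i w i * pair_eval (phi i) p.

Lemma pair_dual_comb (w : I -> R) : pair_dual
  (fun x => \sum_i w i * (phi i).1 x, fun x => \sum_i w i * (phi i).2 x).
Proof. by split; apply: rdual_comb => i; case: (dphi i). Qed.

Lemma pair_eval_comb (w : I -> R) p :
  pair_eval (fun x => \sum_i w i * (phi i).1 x, fun x => \sum_i w i * (phi i).2 x) p
  = \sum_i w i * pair_eval (phi i) p.
Proof.
by rewrite /pair_eval /= -big_split; apply: eq_bigr => i _; rewrite mulrDr.
Qed.

Let deviation_bound : exists B, forall p, P0 p ->
  \sum_i (pair_eval (phi i) p - c i) ^+ 2 <= B.
Proof.
have bnd i : exists B, forall p, P0 p -> (pair_eval (phi i) p - c i) ^+ 2 <= B.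
  have [[l1 [M1 b1]] [l2 [M2 b2]]] := dphi i.
  exists ((`|M1| * gam + `|M2| * t + `|c i|) ^+ 2) => p /P0b [p1 p2].
  have absb f M (x : Y) r : real_linear f -> (forall x, f x <= M * rnorm x) ->
      rnorm x <= r -> `|f x| <= `|M| * r.
    move=> lf fM xr.
    have Mx : M * rnorm x <= `|M| * r.
      apply: le_trans (_ : `|M| * rnorm x <= _); last by rewrite ler_wpM2l.
      by rewrite ler_wpM2r ?rnorm_ge0 ?ler_norm.
    have := fM (- x); rewrite rnormN real_linearN// => h1.
    by rewrite ler_norml lerNl !(le_trans _ Mx).
  rewrite -[leLHS]real_normK ?num_real// lerXn2r ?nnegrE//.
    by apply: le_trans (normr_ge0 _) _;
      apply: le_trans (ler_normB (pair_eval (phi i) p) (c i)) _;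
      rewrite lerD2r (le_trans (ler_normD _ _))// lerD// absb.
  apply: le_trans (ler_normB _ _) _.
  by rewrite lerD2r (le_trans (ler_normD _ _))// lerD// absb.
have [B hB] := choice bnd.
by exists (\sum_i B i) => p Pp; apply: ler_sum => i _; exact: hB.
Qed.

(* Blackwell's approachability: always aiming against the accumulated deviation
   keeps its square norm of order n, so that the averages converge to c, while
   the first components can be chosen to add up their norms. *)
Let approach_sum B y d n : (forall p, P0 p ->
    \sum_i (pair_eval (phi i) p - c i) ^+ 2 <= B) -> 0 < d ->
  exists S : Y * Y, [/\ n = 0%N -> S = 0,
    (0 < n)%N -> pair_hull (rc n%:R^-1 *: S),
    \sum_i (pair_eval (phi i) S - n%:R * c i) ^+ 2 <= n%:R * (B + 2) &
    n%:R * gam + rnorm y - n%:R * d <= rnorm (S.1 + y)].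
Proof.
move=> hB d0; elim: n => [|n [S [S0 Sn Sdev Snorm]]].
  exists 0; split=> //; last by rewrite !mul0r add0r subr0 add0r.
  rewrite mul0r big1// => i _.
  by rewrite pair_eval0// mul0r subrr expr0n.
pose z i := pair_eval (phi i) S - n%:R * c i.
have h2 : 0 < 2^-1 :> R by rewrite invr_gt0.
have [p Pp hp] := reachable (fun i => - z i) h2.
have e0 : 0 < Num.min d 2^-1 by rewrite lt_min d0 h2.
have [q [Pq hq qn]] := slices (S.1 + y) (pair_dual_comb (fun i => - z i)) Pp e0.
rewrite !pair_eval_comb in hq.
(* [reachable] and [slices] lose at most 1/2 each, so twice this cross term stays below the 2 in
   [B + 2]. *)
have zq : \sum_i z i * (pair_eval (phi i) q - c i) < 1.
  have -> : \sum_i z i * (pair_eval (phi i) q - c i) =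
      (\sum_i - z i * c i) - (\sum_i - z i * pair_eval (phi i) q).
    rewrite -sumrB; apply: eq_bigr => i _; ring.
  have : Num.min d 2^-1 <= 2^-1 by rewrite ge_min lexx orbT.
  move: hp hq; lra.
exists (S + q); split=> //.
- move=> _; have [n0|n0] := posnP n.
    by rewrite n0 (S0 n0) add0r invr1 rc1Z; exact: PairHullBase.
  have nR : (0 : R) < n%:R by rewrite ltr0n.
  have -> : rc n.+1%:R^-1 *: (S + q) = rc (n%:R / n.+1%:R) *: (rc n%:R^-1 *: S)
      + rc (1 - n%:R / n.+1%:R) *: q :> Y * Y.
    have -> : 1 - n%:R / n.+1%:R = n.+1%:R^-1 :> R.
      by rewrite -natr1; field; rewrite natr1 pnatr_eq0.
    by rewrite rcZA mulrAC divff ?gt_eqF// mul1r scalerDr.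
  apply: PairHullConv; last exact: PairHullBase; last exact: Sn.
    by rewrite divr_ge0.
  by rewrite ler_pdivrMr ?ltr0n// mul1r ler_nat.
- have -> : \sum_i (pair_eval (phi i) (S + q) - n.+1%:R * c i) ^+ 2 =
    \sum_i z i ^+ 2 + 2 * (\sum_i z i * (pair_eval (phi i) q - c i)) +
    \sum_i (pair_eval (phi i) q - c i) ^+ 2.
    rewrite mulr_sumr -!big_split /=; apply: eq_bigr => i _.
    by rewrite pair_evalD// /z -natr1; ring.
  have := hB _ Pq; move: Sdev; rewrite -/(z _) -natr1 => h1 h3.
  apply: le_trans (lerD (lerD h1 (lexx _)) h3) _; move: zq.
  move: (\sum_i _) => s hs; lra.
- have h : Num.min d 2^-1 <= d by rewrite ge_min lexx.
  have -> : (S + q).1 + y = q.1 + (S.1 + y).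
    by rewrite /= [S.1 + q.1]addrC -addrA.
  by move: qn Snorm h; rewrite -natr1; lra.
Qed.

Lemma approach y eta : 0 < eta -> exists p, [/\ pair_hull p,
    forall i, c i - eta < pair_eval (phi i) p &
    gam + rnorm y - eta < rnorm (p.1 + y)].
Proof.
move=> eta0; have [B hB] := deviation_bound.
have e2 : 0 < eta ^+ 2 by rewrite exprn_gt0.
(* After so many steps the squared deviation of the average, at most [(B + 2) / N], is below
   [eta ^+ 2]. *)
pose N := Num.bound ((`|B| + 2) / eta ^+ 2).
have hN : (`|B| + 2) / eta ^+ 2 < N%:R.
  by apply: archi_boundP; rewrite divr_ge0// ?(ltW e2)// addr_ge0.
have N0 : (0 : R) < N%:R by apply: le_lt_trans hN; rewrite divr_ge0 ?(ltW e2)// addr_ge0.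
have Nn0 : (0 < N)%N by rewrite -(ltr0n R).
have d0 : 0 < eta / (2 * N%:R) by rewrite divr_gt0// mulr_gt0.
have [S [_ /(_ Nn0) PS Sdev Snorm]] := approach_sum y N hB d0.
have SE : S = rc N%:R *: (rc N%:R^-1 *: S) by rewrite rcZA divff ?gt_eqF// rc1Z.
move: PS SE; set p := rc N%:R^-1 *: S => Pp SE.
exists p; split=> // [i|].
- have : (pair_eval (phi i) S - N%:R * c i) ^+ 2 <= N%:R * (B + 2).
    apply: le_trans Sdev; rewrite (bigD1 i)//= lerDl sumr_ge0// => j _.
    exact: sqr_ge0.
  rewrite SE pair_evalZ// -mulrBr exprMn expr2 -mulrA ler_pM2l// => h.
  have {}h : (pair_eval (phi i) p - c i) ^+ 2 < eta ^+ 2.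
    rewrite -(ltr_pM2l N0); apply: le_lt_trans h _.
    move: hN; rewrite ltr_pdivrMr//; apply: le_lt_trans.
    by rewrite lerD2r ler_norm.
  by rewrite ltNge; apply/negP => le_c; nra.
- have [p1 _] := pair_hull_bound Pp.
  (* Since [S.1] is [N] times [p.1], removing [N - 1] copies of norm at most [gam] leaves
     [gam + rnorm y] up to the error. *)
  have -> : p.1 + y = (S.1 + y) - rc (N%:R - 1) *: p.1.
    rewrite [in RHS]SE /= rmorphB scalerBl rc1Z opprB.
    by rewrite addrAC addrCA addrN addr0 addrC.
  have := rnorm_geB (S.1 + y) (- (rc (N%:R - 1) *: p.1)).
  have N1 : 0 <= N%:R - 1 :> R by rewrite subr_ge0 ler1n.
  rewrite rnormN rnorm_rcZ ger0_norm// => h.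
  have h1 : (N%:R - 1) * rnorm p.1 <= (N%:R - 1) * gam by rewrite ler_wpM2l.
  have h2 : N%:R * (eta / (2 * N%:R)) = eta / 2.
    by field; rewrite gt_eqF.
  rewrite h2 in Snorm; lra.
Qed.

End Approach.
(* Adding the norming functional of q.1 + y to the family of functionals keeps
   the norm of q.1 + y large in the later steps. *)
Lemma hull_slices (ys : seq Y) (I : finType) (phi : I -> (Y -> R) * (Y -> R)) p eta :
  (forall i, pair_dual (phi i)) -> pair_hull p -> 0 < eta ->
  exists q, [/\ pair_hull q,
    forall i, pair_eval (phi i) p - eta < pair_eval (phi i) q &
    forall y, y \in ys -> gam + rnorm y - eta < rnorm (q.1 + y)].
Proof.
elim: ys I phi p eta => [|y ys IH] I phi p eta dphi Pp eta0.
  by exists p; split=> // i; rewrite ltrBlDr ltrDl.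
have e2 : 0 < eta / 2 by rewrite divr_gt0.
have [q1 [Pq1 hq1 nq1]] : exists q, [/\ pair_hull q,
    forall i, pair_eval (phi i) p - eta / 2 < pair_eval (phi i) q &
    gam + rnorm y - eta / 2 < rnorm (q.1 + y)].
  apply: approach => // w e e0.
  have [q P0q hq] := pair_hull_slice (pair_dual_comb dphi w) Pp.
  exists q => //; rewrite !pair_eval_comb in hq.
  by apply: lt_le_trans hq; rewrite ltrBlDr ltrDl.
have [g [gb gq1]] := norming (q1.1 + y).
pose phi' (i : option I) := if i is Some j then phi j else (g, fun=> 0).
have d0 : rdual (fun _ : Y => 0 : R).
  by split; [split=> *; rewrite ?addr0 ?mulr0|exists 0 => x; rewrite mul0r].
have dphi' i : pair_dual (phi' i).
  by case: i => [i|] //=; split=> //; exact: rball_dual.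
have [q [Pq hq nq]] := IH _ phi' q1 (eta / 2) dphi' Pq1 e2.
exists q; split=> // [i|z].
  by have := hq (Some i); have := hq1 i; rewrite /=; lra.
rewrite inE => /predU1P[->|/nq]; last lra.
have := hq None; rewrite /pair_eval /= !addr0 => h.
have := gb.2 (q.1 + y); rewrite gb.1.1; move: gq1; rewrite gb.1.1; lra.
Qed.

End Averages.

(** * Weak neighbourhoods *)

Section PhaseNet.
Context {R : realType} {k : scalar_kind}.
Local Notation K := (scalars R k).

Lemma unit_net (d : R) : 0 < d -> exists (I : finType) (om : I -> K),
  (forall i, nm (om i) <= 2) /\ forall z, nm z = 1 -> exists i, nm (om i - z) <= d.
Proof.
rewrite /nm /re; case: k => /= d0.
  exists bool, (fun b => if b then 1 else -1); split.
    by move=> -[]; rewrite ?normrN normr1 ler1n.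
  move=> z z1; exists (0 <= z).
  have [z0|z0] := lerP 0 z; move: z1; rewrite /= ?(ger0_norm z0) ?(ltr0_norm z0).
    by move=> ->; rewrite subrr normr0 ltW.
  by move/eqP; rewrite eqr_oppLR => /eqP ->; rewrite subrr normr0 ltW.
have nmle (a b : R) : complex.Re `|(a +i* b)%C| <= `|a| + `|b|.
  rewrite /= -ler_sqr ?nnegrE ?sqrtr_ge0 ?addr_ge0//.
  rewrite sqr_sqrtr ?addr_ge0 ?sqr_ge0// sqrrD !real_normK ?num_real//.
  by rewrite addrAC lerDl mulrn_wge0 ?mulr_ge0.
(* A grid of mesh [1 / M < d / 4] in the square of side 2; each coordinate errs by at most
   [d / 2]. *)
pose M := (Num.bound (4 / d)).
have hM : 4 / d < M%:R by apply: archi_boundP; rewrite divr_ge0// ltW.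
have M0 : (0 : R) < M%:R by apply: le_lt_trans hM; rewrite divr_ge0// ltW.
pose gr (i : 'I_M.*2.+1) : R := i%:R / M%:R - 1.
have gr1 i : `|gr i| <= 1.
  rewrite ler_norml /gr lerBrDr addNr divr_ge0 ?(ltW M0)//=.
  rewrite lerBlDr ler_pdivrMr// -[1 + 1]/(2%:R) -natrM ler_nat mul2n.
  by rewrite -ltnS.
have grP (a : R) : `|a| <= 1 -> exists i, `|gr i - a| <= d / 2.
  move=> a1; move: (a1); rewrite ler_norml => /andP[a2 a3].
  have aM0 : 0 <= (a + 1) * M%:R by rewrite mulr_ge0 ?(ltW M0)//; lra.
  have := truncn_itv aM0; set j := Num.truncn _ => /andP[j1 j2].
  have jM : (j < M.*2.+1)%N.
    rewrite ltnS -mul2n -(ler_nat R) natrM; apply: le_trans j1 _.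
    by rewrite ler_pM2r//; lra.
  exists (Ordinal jM); rewrite /gr /=.
  have -> : j%:R / M%:R - 1 - a = (j%:R - (a + 1) * M%:R) / M%:R.
    by field; rewrite gt_eqF.
  rewrite normrM normfV (gtr0_norm M0) ler_pdivrMr//.
  apply: (@le_trans _ _ 1).
    rewrite ler_norml; move: j2; rewrite -natr1; lra.
  by move: hM; rewrite ltr_pdivrMr//; lra.
exists ('I_M.*2.+1 * 'I_M.*2.+1)%type, (fun i => (gr i.1 +i* gr i.2)%C); split.
  move=> [i j] /=; apply: le_trans (nmle _ _) _.
  by rewrite (le_trans (lerD (gr1 i) (gr1 j))).
move=> [a b] z1.
have [a1 b1] : `|a| <= 1 /\ `|b| <= 1.
  rewrite -z1 /= -!sqrtr_sqr !ler_sqrt ?addr_ge0 ?sqr_ge0//.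
  by rewrite lerDl lerDr !sqr_ge0.
have [i hi] := grP a a1; have [j hj] := grP b b1.
exists (i, j); simpc; apply: le_trans (nmle _ _) _.
by apply: le_trans (lerD hi hj) _; rewrite -splitr.
Qed.

(** A net point close to the exact phase rotates [a] almost onto the positive half-line. *)
Lemma phase_net (d : R) : 0 < d -> exists (I : finType) (om : I -> K),
  (forall i, nm (om i) <= 2) /\
  forall a, exists i, nm (om i * a - rc (nm a)) <= d * nm a.
Proof.
move=> d0; have [I [om [om2 net]]] := unit_net d0; exists I, om; split=> // a.
have [c [c1 ca]] := phase a; have [i hi] := net c c1; exists i.
by rewrite -ca -mulrBl nmM ler_wpM2r// nm_ge0.
Qed.

End PhaseNet.

Section WeakTopology.
Context {R : realType} {k : scalar_kind}.
Local Notation K := (scalars R k).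
Context {Y : normedModType K}.

(** The sets whose preimage under [dual_eval] contains a basic weak neighbourhood of [d].
    Convergence of this filter in the product yields the usual base of the weak topology. *)
Let weak_nbhs (d : Y) : set_system (prod_topology (fun _ : set_type (@dual R k Y) => K^o)) :=
  [set P | exists (I : finType) (f : I -> {linear Y -> K^o}) (e : R),
    [/\ 0 < e, forall i, dual (f i) &
      forall z, (forall i, nm (f i (z - d)) < e) -> P (dual_eval z)]].

Let weak_nbhs_filter d : Filter (weak_nbhs d).
Proof.
split.
- exists void, (of_void _), 1.
  by split=> // -[].
- move=> P Q [I [f [e [e0 df hP]]]] [J [g [e' [e'0 dg hQ]]]].
  exists (I + J)%type, (fun i => match i with inl i => f i | inr j => g j end),
    (Num.min e e').
  split=> [|[i|j]|z h]; rewrite ?lt_min ?e0//.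
  split; [apply: hP => i; have := h (inl i)|apply: hQ => j; have := h (inr j)];
    by rewrite lt_min => /andP[].
- move=> P Q PQ [I [f [e [e0 df hP]]]]; exists I, f, e; split=> // z hz.
  exact/PQ/hP.
Qed.

Lemma weakly_open_nbhs (U : set Y) d : weakly_open U -> U d ->
  exists (I : finType) (f : I -> {linear Y -> K^o}) (e : R),
    [/\ 0 < e, forall i, dual (f i) &
      forall z, (forall i, nm (f i (z - d)) < e) -> U z].
Proof.
move=> [A oA <-] Ad.
have FF := weak_nbhs_filter d.
have cv : weak_nbhs d --> (dual_eval d : prod_topology (fun _ : set_type (@dual R k Y) => K^o)).
  (* The product topology is a supremum over coordinates, so a single functional is treated at a
     time. *)
  apply/cvg_sup => i P [/= _ [[W oW <-] Wd]] /filterS; apply.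
  have /nbhs_ballP[e e0 eW] : nbhs (dual_eval d i) W by apply: open_nbhs_nbhs.
  exists unit, (fun=> set_val i), (nm e); split.
  - by rewrite -(ltr_rc (k := k)) rmorph0 -(gt0_rcE e0).
  - by move=> _; exact: set_valP.
  - move=> z /(_ tt) hz; apply: eW; rewrite -ball_normE /= distrC.
    rewrite (gt0_rcE e0) nmE ltr_rc; move: hz.
    by rewrite linearB.
have [I [f [e H]]] := cv A (open_nbhs_nbhs (conj oA Ad)).
by exists I, f, e.
Qed.

(* Since a modulus is controlled by the real parts of finitely many rotations,
   weak neighbourhoods are given by finitely many real functionals. *)
Lemma weakly_open_real_nbhs (U : set Y) d : weakly_open U -> U d ->
  exists (I : finType) (h : I -> Y -> R) (e : R),
    [/\ 0 < e, forall i, rdual (h i) &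
      forall z, (forall i, h i d - e < h i z) -> U z].
Proof.
move=> oU Ud; have [I [f [e [e0 df fU]]]] := weakly_open_nbhs oU Ud.
have h2 : 0 < 2^-1 :> R by rewrite invr_gt0.
have [J [om [_ net]]] := @phase_net R k _ h2.
(* The minus sign turns upper bounds for [re (om j * f i (z - d))] into lower bounds for the new
   functionals. With net precision 1/2 the modulus is at most twice this real part, whence
   [e / 2]. *)
exists (I * J)%type, (fun ij y => re (- om ij.2 * f ij.1 y)), (e / 2); split.
- by rewrite divr_gt0.
- move=> [i j] /=; have [M Mb] := (continuous_linear_boundP (f i)).1 (df i).
  split; first split=> [x y|r x].
  + by rewrite linearD mulrDr raddfD.
  + by rewrite linearZ /= [_ *: _]/(_ * _) mulrCA re_rcM.
  + exists (nm (om j) * M) => x; apply: le_trans (re_le_nm _) _.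
    by rewrite nmM nmN -mulrA ler_wpM2l ?nm_ge0// -rnorm_regular.
- move=> z hz; apply: fU => i; have [j hj] := net (f i (z - d)).
  have := hz (i, j) => /=.
  rewrite ltrBlDr -ltrBlDl -raddfB -mulrBr -linearB -opprB linearN mulrNN => h.
  have := re_le_nm (- (om j * f i (z - d) - rc (nm (f i (z - d))))).
  rewrite nmN raddfN raddfB /= rcK; lra.
Qed.

End WeakTopology.

(** * Trees of slices of the dual ball *)

Section DualSlices.
Context {R : realType} {k : scalar_kind}.
Local Notation K := (scalars R k).
Context {Y : normedModType K}.
Implicit Types (y : Y) (l : Y * R) (g : Y -> R).

Lemma finite_min (I : finType) (f : I -> R) : (forall i, 0 < f i) ->
  exists2 e, 0 < e & forall i, e <= f i.
Proof.
move=> f0; suff [e e0 ef] : exists2 e, 0 < e & forall i, i \in enum I -> e <= f i.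
  by exists e => // i; apply: ef; rewrite mem_enum.
elim: (enum I) => [|i s [e e0 es]]; first by exists 1.
exists (Num.min e (f i)); first by rewrite lt_min e0 f0.
by move=> j; rewrite inE ge_min => /predU1P[->|/es->//]; rewrite lexx orbT.
Qed.

(** The weak-star slice of the dual ball determined by the vector [l.1], of depth [l.2]. *)
Definition dual_slice l : set (Y -> R) :=
  [set g | rball g /\ rnorm l.1 - l.2 < g l.1].

Lemma dual_slice_norming l g : 0 < l.2 -> rball g -> g l.1 = rnorm l.1 ->
  dual_slice l g.
Proof. by move=> l0 gb gE; split=> //; rewrite gE ltrBlDr ltrDl. Qed.

(** The vector [y] is replaced by [y + kp s] with small [kp]. Its norm is at least
    [rnorm y + kp * g0 s], and [g y <= rnorm y]; so a functional within [kp * (g0 s - r)] of this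
    norm has [g s > r], while [g y] drops by less than [d]. *)
Lemma dual_slice_shrink l (s : Y) g0 r : 0 < l.2 -> rball g0 ->
  g0 l.1 = rnorm l.1 -> r < g0 s ->
  exists l', 0 < l'.2 /\ forall g, dual_slice l' g -> dual_slice l g /\ r < g s.
Proof.
case: l => y d /= d0 gb0 gy rs.
pose B := 2 * rnorm s + (g0 s - r) + 1.
have B0 : 0 < B by have := rnorm_ge0 s; rewrite /B; lra.
pose kp := d / B; have kp0 : 0 < kp by rewrite divr_gt0.
have kB : kp * B = d by rewrite divfK// gt_eqF.
exists (y + rc kp *: s, kp * (g0 s - r)) => /=; split.
  by rewrite mulr_gt0// subr_gt0.
move=> g [gb /=]; rewrite gb.1.1 gb.1.2 => hg.
have := gb0.2 (y + rc kp *: s); rewrite gb0.1.1 gb0.1.2 gy => h0.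
have gsb := gb.2 s; have g0s := gb0.2 s; have gs1 := rball_ge s gb.
split; last first.
  have hgy := gb.2 y.
  have : kp * r < kp * g s by lra.
  by rewrite ltr_pM2l.
split=> //=.
have : kp * (g s - g0 s + (g0 s - r)) <= kp * (2 * rnorm s + (g0 s - r)).
  by rewrite ler_pM2l//; have := rball_ge s gb0; lra.
have : kp * (2 * rnorm s + (g0 s - r)) < d by rewrite -kB ltr_pM2l// /B; lra.
lra.
Qed.

(** When the norm of [x + y] is almost [gam + rnorm y], a functional almost norming the sum is
    almost maximal at both terms. *)
Lemma dual_slice_add l (x : Y) gam d : rnorm x <= gam -> 0 < l.2 -> 0 < d ->
  gam + rnorm l.1 - Num.min l.2 d / 2 < rnorm (x + l.1) ->
  exists l', 0 < l'.2 /\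
    forall g, dual_slice l' g -> dual_slice l g /\ gam - d < g x.
Proof.
case: l => y e /= xg e0 d0 h.
have m0 : 0 < Num.min e d by rewrite lt_min e0.
have me : Num.min e d <= e by rewrite ge_min lexx.
have md : Num.min e d <= d by rewrite ge_min lexx orbT.
exists (x + y, Num.min e d / 2); split; first by rewrite divr_gt0.
move=> g [gb /=]; rewrite gb.1.1 => hg; rewrite /dual_slice /=.
by have gx := gb.2 x; have gy := gb.2 y; split; [split=> //|]; lra.
Qed.

Variables (P0 : set (Y * Y)) (gam t : R).
Hypothesis P0b : forall p, P0 p -> rnorm p.1 <= gam /\ rnorm p.2 <= t.
Hypothesis slices : forall phi p y eta, pair_dual phi -> P0 p -> 0 < eta ->
  exists q, [/\ P0 q, pair_eval phi p - eta < pair_eval phi q &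
    gam + rnorm y - eta < rnorm (q.1 + y)].

Section Tree.
Variables (p0 : Y * Y) (r d : R).
Hypotheses (Pp0 : pair_hull P0 p0) (d0 : 0 < d).

(** Invariant of a tree level: every slice has positive depth, and its functionals exceed [r] at
    [p0.2], which allows the branch on second components to continue. *)
Let good (L : seq (Y * R)) := forall l, l \in L ->
  0 < l.2 /\ forall g, dual_slice l g -> r < g p0.2.

(** Each slice acquires two subslices: [p.2] is large on one, [p.1] almost maximal on the other. *)
Let refines (L : seq (Y * R)) (p : Y * Y) (L' : seq (Y * R)) :=
  forall l, l \in L ->
    (exists2 l', l' \in L' & forall g, dual_slice l' g ->
       dual_slice l g /\ r < g p.2) /\
    (exists2 l', l' \in L' & forall g, dual_slice l' g ->
       dual_slice l g /\ gam - d < g p.1).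

(** A single pair [p] serves all slices: [hull_slices] keeps the functionals norming their vectors
    above [r] at [p.2], and makes [p.1] almost additive in norm with all these vectors at once. *)
Let tree_step L : good L ->
  exists p L', [/\ pair_hull P0 p, good L' & refines L p L'].
Proof.
move=> gL; have [nf nfP] := choice (@norming R k Y).
pose phi (l : seq_sub L) : (Y -> R) * (Y -> R) := (fun=> 0, nf (ssval l).1).
have dphi j : pair_dual (phi j).
  split; last by apply: rball_dual; exact: (nfP _).1.
  by split; [split=> *; rewrite ?addr0 ?mulr0|exists 0 => x; rewrite mul0r].
have slack (l : seq_sub L) : 0 < nf (ssval l).1 p0.2 - r.
  have [l0 lr] := gL _ (ssvalP l); rewrite subr_gt0; apply: lr.
  by apply: dual_slice_norming => //; have [] := nfP (ssval l).1.
have [e1 e10 he1] := finite_min slack.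
have [e2 e20 he2] : exists2 e, 0 < e & forall l : seq_sub L,
    e <= Num.min (ssval l).2 d / 2.
  apply: finite_min => l; rewrite divr_gt0// lt_min d0 andbT.
  by have [] := gL _ (ssvalP l).
have e0 : 0 < Num.min e1 e2 by rewrite lt_min e10.
have [p [Pp hp np]] := hull_slices P0b slices (map fst L) dphi Pp0 e0.
have m1 : Num.min e1 e2 <= e1 by rewrite ge_min lexx.
have m2 : Num.min e1 e2 <= e2 by rewrite ge_min lexx orbT.
have H1 l : exists l' : Y * R, l \in L -> 0 < l'.2 /\
    forall g, dual_slice l' g -> dual_slice l g /\ r < g p.2.
  have [lL|_] := boolP (l \in L); last by exists l.
  have [nb nE] := nfP l.1.
  have [|l' hl'] := dual_slice_shrink (s := p.2) (r := r) (gL _ lL).1 nb nE.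
    have := hp (SeqSub lL); have := he1 (SeqSub lL).
    by rewrite /pair_eval /= !add0r; lra.
  by exists l'.
have [F1 hF1] := choice H1.
have H0 l : exists l' : Y * R, l \in L -> 0 < l'.2 /\
    forall g, dual_slice l' g -> dual_slice l g /\ gam - d < g p.1.
  have [lL|_] := boolP (l \in L); last by exists l.
  have [|l' hl'] := dual_slice_add (x := p.1) (pair_hull_bound P0b Pp).1 (gL _ lL).1 d0.
    apply: le_lt_trans (np _ (map_f fst lL)); have := he2 (SeqSub lL).
    by rewrite /=; lra.
  by exists l'.
have [F0 hF0] := choice H0.
exists p, (map F1 L ++ map F0 L); split=> //.
- move=> l'; rewrite mem_cat => /orP[] /mapP[l lL ->].
    have [h1 h2] := hF1 _ lL; split=> // g /h2[lg _].
    by have [_] := gL _ lL; apply.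
  have [h1 h2] := hF0 _ lL; split=> // g /h2[lg _].
  by have [_] := gL _ lL; apply.
- move=> l lL; split.
    by exists (F1 l); [rewrite mem_cat map_f|exact: (hF1 _ lL).2].
  by exists (F0 l); [rewrite mem_cat orbC map_f|exact: (hF0 _ lL).2].
Qed.

Lemma separated_tree L0 : good L0 -> (exists l, l \in L0) ->
  exists p : nat -> Y * Y, (forall n, pair_hull P0 (p n)) /\
  forall n (b : nat -> bool), exists g, rball g /\
    forall i, (i < n)%N -> if b i then r < g (p i).2 else gam - d < g (p i).1.
Proof.
move=> gL0 [l0 l0L].
pose S := {L : seq (Y * R) | good L}.
pose Q (x y : S * (Y * Y)) :=
  pair_hull P0 y.2 /\ refines (sval x.1) y.2 (sval y.1).
have step x : {y | Q x y}.
  apply/cid; have [p [L' [Pp gL' rf]]] := tree_step (svalP x.1).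
  by exists (exist _ L' gL', p).
have [f [f0 fS]] := dependent_choice step (exist _ L0 gL0, p0).
(* [f 0] holds only the initial pair, so the pair with index [n] sits in [f n.+1]. *)
exists (fun n => (f n.+1).2); split; first by move=> n; exact: (fS n).1.
move=> n b; suff [l lL hl] : exists2 l, l \in sval (f n).1 & forall g,
    dual_slice l g -> forall i, (i < n)%N ->
    if b i then r < g (f i.+1).2.2 else gam - d < g (f i.+1).2.1.
  have [g [gb gE]] := norming l.1; exists g; split=> //; apply: hl.
  by apply: dual_slice_norming => //; have [] := svalP (f n).1 _ lL.
elim: n => [|n [l lL hl]]; first by exists l0; rewrite ?f0.
have [[l1 l1L h1] [l2 l2L h2]] := (fS n).2 l lL.
case bn : (b n).
  exists l1 => // g /h1[lg gr] i; rewrite ltnS leq_eqVlt => /predU1P[->|]; last exact: hl.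
  by rewrite bn.
exists l2 => // g /h2[lg gr] i; rewrite ltnS leq_eqVlt => /predU1P[->|]; last exact: hl.
by rewrite bn.
Qed.

End Tree.

Lemma separated_sequence p0 d : pair_hull P0 p0 -> 0 < d ->
  exists p : nat -> Y * Y, (forall n, pair_hull P0 (p n)) /\
  forall n (b : nat -> bool), exists g, rball g /\
    forall i, (i < n)%N ->
      if b i then rnorm p0.2 - d < g (p i).2 else gam - d < g (p i).1.
Proof.
move=> Pp0 d0; apply: (@separated_tree p0 (rnorm p0.2 - d) d Pp0 d0 [:: (p0.2, d)]).
  by move=> l; rewrite inE => /eqP->; split=> //= g [].
by exists (p0.2, d); rewrite inE.
Qed.

End DualSlices.

(** * Sequences equivalent to the basis of l_1 *)

Section L1Sequences.
Context {R : realType} {k : scalar_kind}.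
Local Notation K := (scalars R k).

Lemma pigeonhole_sum (n : nat) (I : finType) (cls : 'I_n -> I) (a : 'I_n -> R) (i0 : I) :
  exists j, \sum_(i < n) a i <= (\sum_(i < n | cls i == j) a i) * #|I|%:R.
Proof.
apply: contrapT => /forallNP h.
have : \sum_(j : I) (\sum_(i < n | cls i == j) a i) * #|I|%:R <
    \sum_(j : I) \sum_(i < n) a i.
  apply: ltr_sum => [|j _]; last by rewrite ltNge; exact/negP/h.
  by apply/hasP; exists i0 => //; exact: mem_index_enum.
have e : \sum_(i < n) a i = \sum_j \sum_(i < n | cls i == j) a i.
  by rewrite (partition_big cls predT).
by rewrite sumr_const -mulr_suml -e mulr_natr ltxx.
Qed.

Context {Y : normedModType K}.

(** By the law of cosines, a value of modulus at most [t] and real part almost [t] is close to [t],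
    imaginary part included. *)
Lemma functional_close (t d : R) (F : {linear Y -> K^o}) (s : Y) :
  0 <= t -> (forall x, nm (F x) <= 1 * rnorm x) -> rnorm s <= t ->
  t - d < re (F s) -> nm (F s - rc t) ^+ 2 <= 2 * t * d.
Proof.
move=> t0 Fb st Fs; rewrite nm_subr_sqr.
have h1 : nm (F s) <= t by apply: le_trans (Fb s) _; rewrite mul1r.
have h2 : nm (F s) ^+ 2 <= t ^+ 2.
  by rewrite lerXn2r ?nnegrE// ?nm_ge0.
have h3 : t * (t - d) <= t * re (F s) by rewrite ler_wpM2l// ltW.
by rewrite mulr2n; move: h2 h3; rewrite !expr2; lra.
Qed.

(* The functionals with b = 1 everywhere are nearly constant on the sequence,
   so subtracting the one that is smaller on a block of indices, whose
   coefficients have almost equal phases, isolates the block. *)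
Lemma l1_sequence_of_separation (t e : R) : 0 <= t -> 0 < e ->
  exists2 d0, 0 < d0 & forall s : nat -> Y, (forall n, rnorm (s n) <= t) ->
  (forall n (b : nat -> bool), exists g, rball g /\ forall i, (i < n)%N ->
     if b i then t - d0 < g (s i) else g (s i) < t - e) ->
  l1_sequence s.
Proof.
move=> t0 e0.
have t1 : 0 < t + 1 by lra.
(* With this net precision the phase error on the block, where [nm (w i) <= 2 * t], costs at most
   [e / 2] of the gain [3 / 4 * e]. *)
have dl0 : 0 < e / (4 * (t + 1)) by rewrite divr_gt0// mulr_gt0.
have [I [om [om2 net]]] := @phase_net R k _ dl0.
have [i0 _] := net 0.
pose N : R := #|I|%:R.
have N0 : 0 < N by rewrite ltr0n; apply/card_gt0P; exists i0.
pose th := e / (32 * N).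
have th0 : 0 < th by rewrite divr_gt0// mulr_gt0.
have thN : th * N = e / 32 by rewrite /th; field; rewrite gt_eqF.
(* The first bound gives [re (w i) >= 3 / 4 * e] on the block; the second puts both functionals
   within [th] of [t] off it. *)
pose d0 := Num.min (e / 4) (th ^+ 2 / (2 * (t + 1))).
have d00 : 0 < d0.
  by rewrite lt_min !divr_gt0// ?exprn_gt0// mulr_gt0.
exists d0 => //.
have de : d0 <= e / 4 by rewrite ge_min lexx.
have dth : 2 * t * d0 <= th ^+ 2.
  have : d0 <= th ^+ 2 / (2 * (t + 1)) by rewrite ge_min lexx orbT.
  rewrite ler_pdivlMr ?mulr_gt0// => h; apply: le_trans h.
  by rewrite [leRHS]mulrC ler_wpM2r ?(ltW d00)//; lra.
move=> s st sep; exists th, (t + 1); split=> // n a; split; last first.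
  apply: le_trans (ler_rnorm_sum _ _ _) _; rewrite mulr_sumr.
  apply: ler_sum => i _; rewrite rnormZ mulrC ler_wpM2r ?nm_ge0//.
  by apply: le_trans (st i) _; lra.
set v := \sum_(i < n) a i *: s i.
set S := \sum_(i < n) _.
have [cls hcls] := choice (fun i : 'I_n => net (a i)).
have [j hj] := pigeonhole_sum cls (fun i => nm (a i)) i0.
have ext (b : nat -> bool) : exists F : {linear Y -> K^o},
    (forall x, nm (F x) <= 1 * rnorm x) /\ forall i, (i < n)%N ->
    if b i then t - d0 < re (F (s i)) else re (F (s i)) < t - e.
  have [g [[lg gb] gs]] := sep n b.
  have [F [_ Fg Fb]] : exists F : {linear Y -> K^o}, [/\ dual F,
      forall x, re (F x) = g x & forall x, nm (F x) <= 1 * rnorm x].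
    by apply: complexify => // x; rewrite mul1r.
  by exists F; split=> // i /gs; rewrite Fg.
have [F1 [F1b F1s]] := ext xpredT.
(* The pattern is false exactly on the block [j]; indices from [n] on get the default [true]. *)
have [F2 [F2b F2s]] := ext (fun m => if insub m is Some i then cls i != j else true).
pose w i := F1 (s i) - F2 (s i).
have close (F : {linear Y -> K^o}) (i : 'I_n) : (forall x, nm (F x) <= 1 * rnorm x) ->
    t - d0 < re (F (s i)) -> nm (F (s i) - rc t) <= th.
  move=> Fb Fs; rewrite -ler_sqr ?nnegrE ?nm_ge0 ?(ltW th0)//.
  exact: le_trans (functional_close t0 Fb (st i) Fs) dth.
have wout (i : 'I_n) : cls i != j -> nm (w i) <= 2 * th.
  move=> ij; have := F2s i (ltn_ord i); rewrite valK ij => h2.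
  have c1 := close F1 i F1b (F1s i (ltn_ord i)); have c2 := close F2 i F2b h2.
  have -> : w i = (F1 (s i) - rc t) - (F2 (s i) - rc t).
    by rewrite /w opprB addrA subrK.
  by apply: le_trans (nmB _ _) _; lra.
have win (i : 'I_n) : cls i == j -> 3 / 4 * e <= re (w i) /\ nm (w i) <= 2 * t.
  move=> ij; have := F2s i (ltn_ord i); rewrite valK ij /= => h2.
  have h1 := F1s i (ltn_ord i); split.
    by rewrite /w raddfB /=; move: h1 h2 => /=; lra.
  apply: le_trans (nmB _ _) _; have := F1b (s i); have := F2b (s i).
  have := st i; lra.
have key (i : 'I_n) : (if cls i == j then e / 4 * nm (a i) else 0) - 4 * th * nm (a i)
    <= re (om j * (a i * w i)).
  have a0 := nm_ge0 (a i); have tha : 0 <= th * nm (a i) by rewrite mulr_ge0// ltW.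
  case: ifPn => [ij|ij].
    have [w1 w2] := win i ij; have := hcls i; rewrite (eqP ij) => hi.
    have -> : om j * (a i * w i) = (om j * a i - rc (nm (a i))) * w i + rc (nm (a i)) * w i.
      by rewrite mulrBl subrK mulrA.
    rewrite raddfD /= re_rcM.
    have h3 := re_le_nm (- ((om j * a i - rc (nm (a i))) * w i)).
    rewrite nmN nmM raddfN /= in h3.
    have h4 : nm (om j * a i - rc (nm (a i))) * nm (w i) <=
        e / (4 * (t + 1)) * nm (a i) * (2 * (t + 1)).
      rewrite ler_pM ?nm_ge0//; lra.
    have h5 : e / (4 * (t + 1)) * nm (a i) * (2 * (t + 1)) = e / 2 * nm (a i).
      by field; rewrite gt_eqF.
    have h6 : 3 / 4 * e * nm (a i) <= nm (a i) * re (w i).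
      by rewrite mulrC ler_wpM2l.
    lra.
  have := re_le_nm (- (om j * (a i * w i))); rewrite nmN !nmM raddfN /=.
  have : nm (om j) * (nm (a i) * nm (w i)) <= 2 * (nm (a i) * (2 * th)).
    by rewrite ler_pM ?mulr_ge0 ?nm_ge0// ler_wpM2l// wout.
  lra.
have sumE : om j * (F1 v - F2 v) = \sum_(i < n) om j * (a i * w i) :> K.
  have E (F : {linear Y -> K^o}) : F v = \sum_(i < n) a i * F (s i) :> K.
    by rewrite /v linear_sum; apply: eq_bigr => i _; rewrite linearZ.
  rewrite (E F1) (E F2) mulrBr !mulr_sumr -sumrB; apply: eq_bigr => i _.
  by rewrite /w !mulrBr.
have low : e / 4 * (\sum_(i < n | cls i == j) nm (a i)) - 4 * th * S
    <= re (om j * (F1 v - F2 v) : K).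
  rewrite sumE raddf_sum !mulr_sumr [X in X - _]big_mkcond -sumrB.
  by apply: ler_sum => i _; exact: key.
have up : re (om j * (F1 v - F2 v) : K) <= 4 * rnorm v.
  apply: le_trans (re_le_nm _) _; rewrite nmM.
  have := F1b v; have := F2b v; have := nmB (F1 v) (F2 v) => h1 h2 h3.
  have -> : 4 * rnorm v = 2 * (2 * rnorm v) by lra.
  by rewrite ler_pM ?nm_ge0//; lra.
(* By the choice of [j] the block carries at least [S / N]; as [th * N = e / 32], half of the gain
   survives the losses [4 * th * S]. *)
have SN : e / 4 * S <= e / 4 * (\sum_(i < n | cls i == j) nm (a i)) * N.
  by rewrite -[leRHS]mulrA ler_pM2l ?divr_gt0//.
have -> : th = e / (32 * N) by [].
suff : N * (th * S) <= N * rnorm v by rewrite ler_pM2l.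
have : N * (e / 4 * (\sum_(i < n | cls i == j) nm (a i)) - 4 * th * S) <= N * (4 * rnorm v).
  by rewrite ler_pM2l//; exact: le_trans low up.
have -> : N * (e / 4 * (\sum_(i < n | cls i == j) nm (a i)) - 4 * th * S) =
  e / 4 * (\sum_(i < n | cls i == j) nm (a i)) * N - 4 * (th * N) * S by ring.
have -> : N * (th * S) = th * N * S by ring.
rewrite thN; lra.
Qed.

(* A linear functional below y |-> inf_u (|y - sum_i u_i x_i| / c + sum_i u_i sg_i)
   takes the value sg n at x n. *)
Lemma l1_sequence_signs (x : nat -> Y) : l1_sequence x ->
  forall b : nat -> bool, exists F, dual F /\
    forall n, re ((F : {linear Y -> K^o}) (x n)) = if b n then 1 else -1.
Proof.
move=> [c [M [c0 M0 l1]]] b.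
pose sg n : R := if b n then 1 else -1.
have sg1 n : `|sg n| = 1 by rewrite /sg; case: (b n); rewrite ?normrN normr1.
pose comb (w : nat * (nat -> R)) : Y := \sum_(i < w.1) rc (w.2 i) *: x i.
pose val (w : nat * (nat -> R)) : R := \sum_(i < w.1) w.2 i * sg i.
pose H (w : nat * (nat -> R)) (y : Y) := rnorm (y - comb w) / c + val w.
(* The lower [l_1] estimate bounds [- val w] by [rnorm (comb w) / c], so the infimum is finite. *)
have Hlb w y : - (rnorm y / c) <= H w y.
  have := (l1 w.1 (fun i => rc (w.2 i))).1; rewrite -/(comb w) => h.
  have : - val w <= \sum_(i < w.1) re `|rc (w.2 i) : K|.
    rewrite -sumrN; apply: ler_sum => i _; rewrite -[re _]/(nm _) nm_rc.
    by apply: le_trans (ler_norm _) _; rewrite normrN normrM sg1 mulr1.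
  rewrite -(ler_pM2l c0) => h2.
  have := rnormB y (y - comb w); rewrite subKr => h3.
  rewrite /H -(ler_pM2l c0) mulrDr mulrN ![c * (_ / c)]mulrCA divff ?gt_eqF// !mulr1.
  lra.
have sp : sublinear (fun y => inf [set H w y | w in setT]).
  apply: (@inf_sublinear _ _ _ _ setT H (fun y => - (rnorm y / c))).
  - by exists (0%N, fun=> 0).
  - by move=> w y _; exact: Hlb.
  - move=> [n u] [m w] y z _ _.
    (* Coefficients are extended by 0 to a common length before they are added. *)
    pose un i := if (i < n)%N then u i else 0.
    pose wm i := if (i < m)%N then w i else 0.
    have pad (V : nmodType) (f : nat -> R -> V) p q (r : nat -> R) :
        (p <= q)%N -> (forall i, f i 0 = 0) ->
       \sum_(i < q) f i (if (i < p)%N then r i else 0) = \sum_(i < p) f i (r i).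
      move=> pq f0; rewrite (big_ord_widen q (fun i => f i (r i)) pq) [in RHS]big_mkcond.
      by apply: eq_bigr => i _; case: ifP.
    exists (maxn n m, fun i => un i + wm i) => //.
    have -> : H (maxn n m, fun i => un i + wm i) (y + z) =
      rnorm ((y - comb (n, u)) + (z - comb (m, w))) / c + (val (n, u) + val (m, w)).
      rewrite /H; congr (rnorm _ / c + _).
        rewrite addrACA -opprD; congr (_ - _); rewrite /comb /=.
        rewrite -(pad _ (fun i r => rc r *: x i) n (maxn n m)) ?leq_maxl//; last first.
          by move=> i; rewrite rmorph0 scale0r.
        rewrite -(pad _ (fun i r => rc r *: x i) m (maxn n m)) ?leq_maxr//; last first.
          by move=> i; rewrite rmorph0 scale0r.
        by rewrite -big_split; apply: eq_bigr => i _; rewrite rmorphD scalerDl.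
      rewrite /val /=.
      rewrite -(pad _ (fun i r => r * sg i) n (maxn n m)) ?leq_maxl//; last first.
        by move=> i; rewrite mul0r.
      rewrite -(pad _ (fun i r => r * sg i) m (maxn n m)) ?leq_maxr//; last first.
        by move=> i; rewrite mul0r.
      by rewrite -big_split; apply: eq_bigr => i _; rewrite mulrDl.
    rewrite /H [leRHS]addrACA lerD2r -mulrDl ler_pM2r ?invr_gt0//.
    exact: rnormD.
  - move=> [n u] r y r0 _; exists (n, fun i => r * u i) => //.
    rewrite /H mulrDr; rewrite le_eqVlt; apply/orP; left; apply/eqP; congr (_ + _).
      rewrite mulrA; congr (_ / c).
      have -> : rc r *: y - comb (n, fun i => r * u i) = rc r *: (y - comb (n, u)).
        rewrite scalerBr; congr (_ - _); rewrite /comb /= scaler_sumr.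
        by apply: eq_bigr => i _; rewrite rcZA.
      by rewrite rnorm_rcZ gtr0_norm.
    by rewrite /val /= mulr_sumr; apply: eq_bigr => i _; rewrite mulrA.
have ple w y : inf [set H w y | w in setT] <= H w y.
  apply: ge_inf; last by exists w.
  by exists (- (rnorm y / c)) => _ [w' _ <-]; exact: Hlb.
have [f [lf fp]] := sublinear_minorant sp.
have fb y : f y <= c^-1 * rnorm y.
  apply: le_trans (fp y) _; apply: le_trans (ple (0%N, fun=> 0) y) _.
  by rewrite /H /comb /val !big_ord0 subr0 addr0 mulrC.
(* The combination [r x_n] cancels the norm term; [r = 1] and [r = -1] then fix [f (x n)]. *)
have fle n r : f (rc r *: x n) <= r * sg n.
  apply: le_trans (fp _) _.
  apply: le_trans (ple (n.+1, fun i => if i == n then r else 0) _) _.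
  rewrite /H /comb /val !big_ord_recr /= !eqxx !big1 ?add0r.
  - by rewrite subrr rnorm0 mul0r add0r.
  - by move=> i _; rewrite ltn_eqF// mul0r.
  - by move=> i _; rewrite ltn_eqF// rmorph0 scale0r.
have [F [dF Fg _]] := complexify lf fb.
exists F; split=> // n; rewrite Fg -/(sg n); apply/eqP; rewrite eq_le.
have := fle n 1; have := fle n (-1); rewrite !lf.2 => h1 h2.
by apply/andP; split; lra.
Qed.

(** Diagonal argument: a countable set approximating all sign functionals on [range x] would realise
    every sign pattern, but the pattern opposite at [n] to its [n]-th member is missed. *)
Lemma asplund_no_l1 (C : set Y) : asplund_property C -> no_l1_sequences C.
Proof.
move=> aC x Cx l1.
have [||D [Dd cD Dsep]] := aC (range x).
- by move=> _ [n _ <-].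
- exact: card_le_trans (card_image_le _ _) (countableP _).
have sgn (b : nat -> bool) : exists2 g, D g & forall n, (0 < re (g (x n))) = b n.
  have [F [dF Fx]] := l1_sequence_signs l1 b.
  have [g Dg hg] := Dsep F dF 1 ltr01; exists g => // n.
  have : ((nm (F (x n) - g (x n)))%:E < 1%:E)%E.
    apply: le_lt_trans hg; apply: ereal_sup_ubound.
    by exists (x n) => //; exists n.
  rewrite lte_fin => h.
  have h1 : re (F (x n)) - re (g (x n)) <= nm (F (x n) - g (x n)).
    by rewrite -raddfB; exact: re_le_nm.
  have h2 : re (g (x n)) - re (F (x n)) <= nm (F (x n) - g (x n)).
    by rewrite -raddfB -nmN opprB; exact: re_le_nm.
  rewrite !Fx in h1 h2.
  case: (b n) h1 h2 => h1 h2; first by lra.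
  by apply/negbTE; rewrite -leNgt; lra.
have [f fD] : exists f : nat -> {linear Y -> K^o}, D `<=` range f.
  have /countable_injP[h hinj] := cD.
  have H n : exists g, forall g', D g' -> h g' = n -> g' = g.
    have [[g [Dg hg]]|nog] := pselect (exists g, D g /\ h g = n).
      by exists g => g' Dg' hg'; apply: hinj; rewrite ?inE// hg hg'.
    by exists \0%R => g' Dg' hg'; exfalso; apply: nog; exists g'.
  have [f hf] := choice H; exists f => g Dg.
  by exists (h g) => //; rewrite -(hf (h g) g).
have [g Dg hg] := sgn (fun n => ~~ (0 < re (f n (x n)))).
have [n _ fn] := fD g Dg.
by have := hg n; rewrite fn; case: (0 < _).
Qed.

End L1Sequences.

(** * The Daugavet equation *)

Section ConvexHull.
Context {R : realType} {k : scalar_kind}.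
Local Notation K := (scalars R k).
Context {Y : normedModType K}.
Implicit Types A : set Y.

(** Coefficients in [K] between 0 and 1 are real. *)
Lemma convex_setP A : @convex_set K Y A <-> forall (r : R) (x y : Y),
  0 <= r -> r <= 1 -> A x -> A y -> A (rc r *: x + rc (1 - r) *: y).
Proof.
split=> [cA r x y r0 r1 Ax Ay|hA x y l /set_mem Ax /set_mem Ay].
  have r0' : 0 <= rc r :> K by rewrite -(rmorph0 rc) ler_rc.
  have r1' : rc r <= 1 :> K by rewrite -(rmorph1 rc) ler_rc.
  have := cA x y (Itv01 r0' r1') (mem_set Ax) (mem_set Ay) => /set_mem.
  by rewrite rmorphB rmorph1.
apply/mem_set; have l0 : 0 <= l%:num by [].
have l1 : l%:num <= 1 by [].
have -> : conv l x y = l%:num *: x + (1 - l%:num) *: y by [].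
move: (l%:num) l0 l1 => m m0 m1; have mE : m = rc (nm m) by rewrite -nmE ger0_norm.
have := hA (nm m) x y (nm_ge0 _); rewrite rmorphB rmorph1 /= -mE; apply => //.
by rewrite -(ler_rc (k := k)) -mE rmorph1.
Qed.

Lemma closure_rnormP A z :
  closure A z <-> forall e : R, 0 < e -> exists2 a, A a & rnorm (z - a) < e.
Proof.
split=> [cAz e e0|h B /nbhs_ballP[e e0]].
  have [|a [Aa]] := cAz (ball z (rc e)).
    by apply: nbhsx_ballx; rewrite -(rmorph0 rc) ltr_rc.
  by rewrite -ball_normE /= normE ltr_rc => h; exists a.
rewrite -ball_normE => eB; have [|a Aa za] := h (nm e).
  by rewrite -(ltr_rc (k := k)) rmorph0 -(gt0_rcE e0).
by exists a; split=> //; apply: eB; rewrite /= (gt0_rcE e0) normE ltr_rc.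
Qed.

Lemma closed_convex_hull_convex A : @convex_set K Y (closed_convex_hull A).
Proof.
apply/convex_setP => r x y r0 r1 /closure_rnormP Cx /closure_rnormP Cy.
apply/closure_rnormP => e e0.
have [a Aa xa] := Cx e e0; have [b Ab yb] := Cy e e0.
exists (rc r *: a + rc (1 - r) *: b).
  by move=> B [cB AB]; apply: (convex_setP B).1 => //; [exact: Aa|exact: Ab].
have -> : rc r *: x + rc (1 - r) *: y - (rc r *: a + rc (1 - r) *: b) =
    rc r *: (x - a) + rc (1 - r) *: (y - b).
  by rewrite !scalerBr opprD addrACA.
apply: le_lt_trans (rnormD _ _) _.
rewrite !rnorm_rcZ !ger0_norm ?subr_ge0//.
have [->|rn0] := eqVneq r 0; first by rewrite mul0r add0r subr0 mul1r.
have rgt : 0 < r by rewrite lt_neqAle eq_sym rn0.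
have : r * rnorm (x - a) < r * e by rewrite ltr_pM2l.
have : (1 - r) * rnorm (y - b) <= (1 - r) * e by rewrite ler_wpM2l ?subr_ge0// ltW.
lra.
Qed.

Lemma sub_closed_convex_hull A : A `<=` closed_convex_hull A.
Proof. by move=> a Aa; apply: subset_closure => B [_]; apply. Qed.

(** Otherwise the half-space [h <= h d - e] would contain [A], hence its convex hull, which has
    points too close to [d] for that. *)
Lemma closed_convex_hull_functional A (h : Y -> R) d e : rdual h ->
  closed_convex_hull A d -> 0 < e -> exists2 a, A a & h d - e < h a.
Proof.
move=> [lh [M hM]] /closure_rnormP Cd e0; apply: contrapT => nA.
have M1 : 0 < `|M| + 1 by rewrite ltr_wpDl.
have e2 : 0 < e / (2 * (`|M| + 1)) by rewrite divr_gt0// mulr_gt0.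
have [b Hb db] := Cd _ e2.
have : h b <= h d - e.
  apply: (Hb [set z | h z <= h d - e]); split.
    apply/convex_setP => r x y r0 r1 /= hx hy; rewrite lh.1 !lh.2.
    have -> : h d - e = r * (h d - e) + (1 - r) * (h d - e) by ring.
    by rewrite lerD// ler_wpM2l// subr_ge0.
  by move=> a Aa /=; rewrite leNgt; apply/negP => ha; apply: nA; exists a.
have := hM (d - b); rewrite real_linearB// => h1.
have h2 : M * rnorm (d - b) <= (`|M| + 1) * rnorm (d - b).
  by rewrite ler_wpM2r ?rnorm_ge0//; have := ler_norm M; lra.
have : (`|M| + 1) * rnorm (d - b) < (`|M| + 1) * (e / (2 * (`|M| + 1))).
  by rewrite ltr_pM2l.
have -> : (`|M| + 1) * (e / (2 * (`|M| + 1))) = e / 2 by field; rewrite gt_eqF.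
lra.
Qed.

Lemma diam_lt A (e : R) x y : (diam A < e%:E)%E -> A x -> A y -> rnorm (x - y) < e.
Proof.
move=> dA Ax Ay; rewrite -lte_fin; apply: le_lt_trans dA.
by apply: ereal_sup_ubound; exists x => //; exists y.
Qed.

End ConvexHull.

(** * Slope pairs of the two maps and the lower bound in each case *)

Section DaugavetEquation.
Context {R : realType} {k : scalar_kind}.
Local Notation K := (scalars R k).
Context {X Y : normedModType K}.
Variables (G : {linear X -> Y}) (T : X -> Y) (L : R).
Hypotheses (cG : bounded_operators G) (daugG : daugavet_center G).
Hypothesis TL : forall u v, rnorm (T u - T v) <= L * rnorm (u - v).
Hypothesis X_neq0 : exists u v : X, u != v.

Local Notation gam := (opnorm G).
Local Notation t := (lipnorm T).
Local Notation N := (lipnorm (G \+ T)).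
Local Notation C := (closed_convex_hull (slope T)).

(** Both slopes use the same [u] and [v], so the sum of the components is a slope of [G \+ T]. *)
Definition slope_pairs : set (Y * Y) := [set p | exists u v, u != v /\
  p = (quotient_slope G u v, quotient_slope T u v)].

Local Notation P0 := slope_pairs.

Lemma GT_lipschitz u v : rnorm ((G \+ T) u - (G \+ T) v) <= (gam + t) * rnorm (u - v).
Proof.
have -> : (G \+ T) u - (G \+ T) v = G (u - v) + (T u - T v).
  by rewrite linearB /= opprD addrACA.
apply: le_trans (rnormD _ _) _; rewrite mulrDl lerD ?opnorm_le_norm//.
exact: lipnorm_ub TL u v.
Qed.

Lemma rnorm_quotient_slope (S : X -> Y) M u v :
  rnorm (S u - S v) <= M * rnorm (u - v) -> u != v ->
  rnorm (quotient_slope S u v) <= M.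
Proof.
move=> h uv; have n0 : 0 < rnorm (u - v) by rewrite rnorm_gt0 subr_eq0.
by rewrite quotient_slopeE rnorm_rcZ gtr0_norm ?invr_gt0// mulrC ler_pdivrMr.
Qed.

Lemma slope_pairs_bound p : P0 p -> rnorm p.1 <= gam /\ rnorm p.2 <= t.
Proof.
move=> [u [v [uv ->]]]; split; apply: rnorm_quotient_slope => //.
  by rewrite -linearB opnorm_le_norm.
exact: lipnorm_ub TL u v.
Qed.

(** [lipschitz_slice] is applied to the real Lipschitz function [phi.1 (G x) + phi.2 (T x)], whose
    quotients are the values of [phi] at slope pairs. *)
Lemma slope_pairs_slices phi p y eta : pair_dual phi -> P0 p -> 0 < eta ->
  exists q, [/\ P0 q, pair_eval phi p - eta < pair_eval phi q &
    gam + rnorm y - eta < rnorm (q.1 + y)].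
Proof.
move=> [[l1 [M1 b1]] [l2 [M2 b2]]] [u [v [uv ->]]] eta0.
pose F x := phi.1 (G x) + phi.2 (T x).
have Feval a b : pair_eval phi (quotient_slope G a b, quotient_slope T a b) =
    (F a - F b) / rnorm (a - b).
  rewrite /pair_eval /= !quotient_slopeE l1.2 l2.2.
  by rewrite (real_linearB _ _ l1) (real_linearB _ _ l2) /F; ring.
have FL a b : F a - F b <= (`|M1| * gam + `|M2| * t) * rnorm (a - b).
  have -> : F a - F b = phi.1 (G (a - b)) + phi.2 (T a - T b).
    by rewrite linearB (real_linearB _ _ l1) (real_linearB _ _ l2) /F opprD addrACA.
  have bnd f M (z : Y) c : (forall x, f x <= M * rnorm x) -> rnorm z <= c ->
      f z <= `|M| * c.
    move=> fM zc; apply: le_trans (fM z) _; apply: le_trans (_ : `|M| * rnorm z <= _).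
      by rewrite ler_wpM2r ?rnorm_ge0 ?ler_norm.
    by rewrite ler_wpM2l.
  rewrite mulrDl -!mulrA lerD// bnd// ?opnorm_le_norm//.
  exact: lipnorm_ub TL a b.
have [a [b [ab h1 h2]]] := lipschitz_slice cG daugG y FL uv eta0.
by exists (quotient_slope G a b, quotient_slope T a b); split; [exists a, b|rewrite !Feval|].
Qed.

Lemma slope_pairs_sum p : pair_hull P0 p -> rnorm (p.1 + p.2) <= N.
Proof.
elim=> {p} [p [u [v [uv ->]]]|r p q r0 r1 _ hp _ hq] /=.
  have -> : quotient_slope G u v + quotient_slope T u v = quotient_slope (G \+ T) u v.
    by rewrite /quotient_slope -scalerDr addrACA -opprD.
  by apply: rnorm_quotient_slope => //; exact: lipnorm_ub GT_lipschitz u v.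
rewrite addrACA -!scalerDr; apply: le_trans (rnormD _ _) _.
rewrite !rnorm_rcZ !ger0_norm ?subr_ge0//.
have -> : N = r * N + (1 - r) * N by ring.
by rewrite lerD// ler_wpM2l// subr_ge0.
Qed.

Lemma slope_pairs_hull p : pair_hull P0 p -> C p.2.
Proof.
elim=> {p} [p [u [v [uv ->]]]|r p q r0 r1 _ hp _ hq] /=.
  by apply: sub_closed_convex_hull; exists u, v.
exact: (convex_setP C).1 (@closed_convex_hull_convex _ _ _ (slope T)) r _ _ r0 r1 hp hq.
Qed.

Lemma almost_norming_pair e : 0 < e -> exists2 p, P0 p & t - e < rnorm p.2.
Proof.
move=> e0; have [u [v [uv h]]] := lipnorm_adherent TL X_neq0 e0.
exists (quotient_slope G u v, quotient_slope T u v); first by exists u, v.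
have n0 : 0 < rnorm (u - v) by rewrite rnorm_gt0 subr_eq0.
by rewrite /= quotient_slopeE rnorm_rcZ gtr0_norm ?invr_gt0// mulrC.
Qed.

(** Approachability with [y = d] gives a pair with [p.2] within [e] of [d] and [p.1 + d] of norm
    above [gam + rnorm d - e]; replacing [d] by [p.2] costs another [e]. *)
Lemma small_weak_neighbourhood (I : finType) (h : I -> Y -> R) (c : I -> R) d e :
  (forall i, rdual (h i)) -> C d -> (forall i, c i < h i d) -> 0 < e ->
  (forall z, C z -> (forall i, c i < h i z) -> rnorm (z - d) < e) ->
  gam + rnorm d - 2 * e <= N.
Proof.
move=> dh Cd hd e0 small.
have [m m0 mh] : exists2 m, 0 < m & forall i, m <= h i d - c i.
  by apply: finite_min => i; rewrite subr_gt0.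
have me0 : 0 < Num.min m e by rewrite lt_min m0.
pose phi i : (Y -> R) * (Y -> R) := (fun=> 0, h i).
have dphi i : pair_dual (phi i).
  split; last exact: dh.
  by split; [split=> *; rewrite ?addr0 ?mulr0|exists 0 => x; rewrite mul0r].
have [|p [Pp hp np]] := approach slope_pairs_bound slope_pairs_slices
    (c := fun i => h i d) dphi _ d me0.
  move=> w eta eta0.
  have [_ [u [v [uv ->]]] huv] := closed_convex_hull_functional
    (rdual_comb (index_enum I) w dh) Cd eta0.
  exists (quotient_slope G u v, quotient_slope T u v); first by exists u, v.
  apply: lt_le_trans huv _; apply: ler_sum => i _.
  by rewrite /pair_eval /= add0r.
have mm : Num.min m e <= m by rewrite ge_min lexx.
have mme : Num.min m e <= e by rewrite ge_min lexx orbT.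
have pd : rnorm (p.2 - d) < e.
  apply: small; first exact: slope_pairs_hull.
  move=> i; have := hp i; have := mh i; rewrite /pair_eval /= add0r; lra.
have := slope_pairs_sum Pp.
have := rnorm_geB (p.1 + d) (p.2 - d).
rewrite addrACA addrN addr0.
lra.
Qed.

Lemma radon_nikodym_daugavet : radon_nikodym_property C -> gam + t <= N.
Proof.
move=> rnp; rewrite leNgt; apply/negP => lt.
(* A quarter of the gap: one [e] is lost as [rnorm d > t - e] and two in
   [small_weak_neighbourhood]. *)
pose e := (gam + t - N) / 4.
have e0 : 0 < e by rewrite divr_gt0// subr_gt0.
have [p0 P0p0 np0] := almost_norming_pair e0.
have [g [gb gE]] := norming p0.2.
have Cp0 : C p0.2 by apply: slope_pairs_hull; exact: PairHullBase.
have [|_ [[f [a [df _ ->]]] [d [[Cd gd] fd]] small]] :=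
    rnp (C `&` [set y | t - e < g y]) (fun y Hy => Hy.1) _ e e0.
  by exists p0.2; split=> //=; rewrite gE.
pose h (b : bool) : Y -> R := if b then g else fun y => re (f y).
pose c (b : bool) : R := if b then t - e else a.
have := @small_weak_neighbourhood _ h c d e; have := gb.2 d; move: gd => /= gd gdb.
suff H : gam + rnorm d - 2 * e <= N by move=> _; rewrite /e in gd H; lra.
apply: (@small_weak_neighbourhood _ h c) => //.
- by move=> [] /=; [exact: rball_dual|exact: dual_rdual].
- by move=> [].
- move=> z Cz hz; apply: (diam_lt small); last by split.
  by split; [split=> //; exact: (hz true)|exact: (hz false)].
Qed.

Lemma CPCP_daugavet : CPCP C -> gam + t <= N.
Proof.
move=> cpcp; rewrite leNgt; apply/negP => lt.
pose e := (gam + t - N) / 4.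
have e0 : 0 < e by rewrite divr_gt0// subr_gt0.
have [p0 P0p0 np0] := almost_norming_pair e0.
have [g [gb gE]] := norming p0.2.
have Cp0 : C p0.2 by apply: slope_pairs_hull; exact: PairHullBase.
(* The half-space is closed because CPCP concerns closed sets; the point [d] found below may thus
   lie on its boundary. *)
pose D := C `&` [set y | t - e <= g y].
have cD : @convex_set K Y D.
  apply/convex_setP => r x y r0 r1 [Cx gx] [Cy gy]; split.
    exact: (convex_setP C).1 (@closed_convex_hull_convex _ _ _ (slope T)) r _ _ r0 r1 Cx Cy.
  rewrite /= gb.1.1 !gb.1.2.
  have -> : t - e = r * (t - e) + (1 - r) * (t - e) by ring.
  by rewrite lerD// ler_wpM2l// subr_ge0.
have clD : closed D.
  apply: closedI; first exact: closed_closure.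
  move=> z /closure_rnormP hz /=; rewrite leNgt; apply/negP => gz.
  have [|a /= ga za] := hz (t - e - g z); first by rewrite subr_gt0.
  have := gb.2 (a - z); rewrite rnorm_subC real_linearB//; last exact: gb.1.
  lra.
have [|U [oU [d [[Cd gd] Ud]] small]] := cpcp D (fun y Hy => Hy.1) _ clD cD e e0.
  by exists p0.2; split=> //=; rewrite gE ltW.
have [I [h [e' [e'0 dh hU]]]] := weakly_open_real_nbhs oU Ud.
(* Moving [d] towards [p0.2] by a fraction [s] makes the bound on [g] strict; [s] is small enough to
   stay in the weak neighbourhood, and [None] ensures [s <= 1]. *)
have [s s0 hs] : exists2 s, 0 < s & forall i : option I, s <=
    if i is Some j then e' / (`|h j p0.2 - h j d| + 1) else 1.
  by apply: finite_min => -[i|]//; rewrite divr_gt0// ltr_wpDl.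
have s1 : s <= 1 := hs None.
pose d' := rc s *: p0.2 + rc (1 - s) *: d.
have Cd' : C d'.
  exact: (convex_setP C).1 (@closed_convex_hull_convex _ _ _ (slope T)) s _ _ (ltW s0) s1 Cp0 Cd.
have gd' : t - e < g d'.
  rewrite gb.1.1 !gb.1.2 gE; have : s * (t - e) < s * rnorm p0.2 by rewrite ltr_pM2l.
  have : (1 - s) * (t - e) <= (1 - s) * g d by rewrite ler_wpM2l// subr_ge0.
  lra.
have hd' i : h i d - e' < h i d'.
  have [lh _] := dh i; rewrite lh.1 !lh.2.
  have n1 : 0 < `|h i p0.2 - h i d| + 1 by rewrite ltr_wpDl.
  have := hs (Some i); rewrite ler_pdivlMr// => h1.
  have := ler_norm (- (h i p0.2 - h i d)); rewrite normrN => h2.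
  have : s * - (h i p0.2 - h i d) <= s * `|h i p0.2 - h i d| by rewrite ler_pM2l.
  lra.
pose h' (i : option I) : Y -> R := if i is Some j then h j else g.
pose c (i : option I) : R := if i is Some j then h j d - e' else t - e.
have H : gam + rnorm d' - 2 * e <= N.
  apply: (@small_weak_neighbourhood _ h' c) => //.
  - by move=> [i|] /=; [exact: dh|exact: rball_dual].
  - by move=> [i|] /=.
  - move=> z Cz hz; apply: (diam_lt small).
      by split; [split=> //; exact: ltW (hz None)|apply: hU => i; exact: hz (Some i)].
    by split; [split=> //; exact: ltW|apply: hU].
have := gb.2 d'; rewrite /e in gd' H; lra.
Qed.

Lemma no_l1_daugavet : no_l1_sequences C -> gam + t <= N.
Proof.
move=> nol1; rewrite leNgt; apply/negP => lt.
have t0 : 0 <= t.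
  have [p0 P0p0 _] := almost_norming_pair ltr01.
  exact: le_trans (rnorm_ge0 _) (slope_pairs_bound P0p0).2.
(* Half the gap: if [g] exceeds [gam - e] at [(p i).1], then it is below [N - gam + e = t - e] at
   [(p i).2]. *)
pose e := (gam + t - N) / 2.
have e0 : 0 < e by rewrite divr_gt0// subr_gt0.
have [d0 d00 l1] := @l1_sequence_of_separation _ _ Y _ _ t0 e0.
have d02 : 0 < d0 / 2 by rewrite divr_gt0.
(* One [d0 / 2] is spent on the norm of [p0.2], the other on the tree. *)
have [p0 P0p0 np0] := almost_norming_pair d02.
have m0 : 0 < Num.min (d0 / 2) e by rewrite lt_min d02.
have m1 : Num.min (d0 / 2) e <= d0 / 2 by rewrite ge_min lexx.
have m2 : Num.min (d0 / 2) e <= e by rewrite ge_min lexx orbT.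
have [p [Pp sep]] := separated_sequence slope_pairs_bound slope_pairs_slices
  (PairHullBase P0p0) m0.
apply: (nol1 (fun n => (p n).2)); first by move=> n; exact: slope_pairs_hull.
apply: l1; first by move=> n; exact: (pair_hull_bound slope_pairs_bound (Pp n)).2.
move=> n b; have [g [gb gs]] := sep n b; exists g; split=> // i /gs.
case: (b i) => h /=; first lra.
have := slope_pairs_sum (Pp i); have := gb.2 ((p i).1 + (p i).2); rewrite gb.1.1.
have : 2 * e = opnorm G + t - N by rewrite /e mulrC divfK.
lra.
Qed.

End DaugavetEquation.

Theorem corollary2p11 (R : realType) (k : scalar_kind)
    (X Y : completeNormedModType (scalars R k)) (G : {linear X -> Y}) :
  bounded_operators G -> daugavet_center G ->
  forall T : X -> Y, Lip0 T ->
    let C := closed_convex_hull (slope T) in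
    [\/ radon_nikodym_property C, asplund_property C, CPCP C
      | no_l1_sequences C] ->
    lipnorm (G \+ T) = opnorm G + lipnorm T.
Proof.
move=> cG daugG T [lT _] C HC; have [L TL] := lipschitz_rnorm lT.
have [X_neq0|X0] := pselect (exists u v : X, u != v); last first.
  (* For trivial [X] there are no quotients, and the supremum of the empty set is 0 by default. *)
  have lip0 (S : X -> Y) : lipnorm S = 0.
    rewrite /lipnorm (_ : [set _ | _] = set0) ?sup0//.
    by apply/seteqP; split=> // r [u [v [uv _]]]; apply: X0; exists u, v.
  have [M Mb] := (continuous_linear_boundP G).1 cG.
  rewrite !lip0 addr0; apply/eqP; rewrite eq_le (opnorm_ge0 Mb)/=.
  apply: (opnorm_le Mb) => x _; have [->|x0] := eqVneq x 0.
    by rewrite linear0 rnorm0.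
  by exfalso; apply: X0; exists x, 0.
apply/eqP; rewrite eq_le; apply/andP; split.
  by apply: lipnorm_le => // u v; exact: GT_lipschitz cG TL u v.
case: HC => [rnp|asp|cpcp|nol1].
- exact: radon_nikodym_daugavet cG daugG TL X_neq0 rnp.
- exact: no_l1_daugavet cG daugG TL X_neq0 (asplund_no_l1 asp).
- exact: CPCP_daugavet cG daugG TL X_neq0 cpcp.
- exact: no_l1_daugavet cG daugG TL X_neq0 nol1.
Qed.
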